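(* Let $L$ be any leaf of the hyper-Lie Poisson structure $(\pi_1,\pi_2,\pi_3)$ on $\mathfrak{su}(2)^3_\star$, with its induced hypersymplectic structure. (i) If the metric on $L$ is positive definite, i.e. $L\subset\mathfrak{su}(2)^3_-$, then there exist $q,r\ge0$ and an isomorphism of hyperkähler structures between $L$ and $N_{q,r}$. (ii) If the metric on $L$ is negative definite, i.e. $L\subset\mathfrak{su}(2)^3_+$, then there exist $q',r'\geq 0$ and an anti-isomorphism between $L$ and $N_{q',r'}$.
   Context: $\langle\cdot,\cdot\rangle$ is the positive definite Ad-invariant inner product on $\mathfrak{su}(2)$ normalized so that $(\mathfrak{su}(2),[\cdot,\cdot],\langle\cdot,\cdot\rangle)\cong(\mathbb{R}^3,\times,\cdot)$, i.e. $\langle x,y\rangle=-2\operatorname{tr}(xy)$. Let $\Phi(a_1,a_2,a_3)=\langle a_1,[a_2,a_3]\rangle$ on $\mathfrak{su}(2)^3$, and let $\mathfrak{su}(2)^3_\star$, $\mathfrak{su}(2)^3_+$, $\mathfrak{su}(2)^3_-$ be the open subsets where $\Phi\ne0$, $\Phi>0$, $\Phi<0$. For $\xi\in\mathfrak{su}(2)$ let $l^j_\xi(a_1,a_2,a_3)=\langle\xi,a_j\rangle$. On $\mathfrak{su}(2)^3_\star$ let $A_{\xi,\zeta}=\frac1\Phi\big(\langle[a_1,a_2],\xi\rangle\langle[a_1,a_2],\zeta\rangle+\langle[a_2,a_3],\xi\rangle\langle[a_2,a_3],\zeta\rangle+\langle[a_3,a_1],\xi\rangle\langle[a_3,a_1],\zeta\rangle\big)$.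 The bivector field $\pi_1$ is given by $\{l^1_\xi,l^1_\zeta\}=l^1_{[\xi,\zeta]}$, $\{l^1_\xi,l^2_\zeta\}=\{l^2_\xi,l^1_\zeta\}=l^2_{[\xi,\zeta]}$, $\{l^1_\xi,l^3_\zeta\}=\{l^3_\xi,l^1_\zeta\}=l^3_{[\xi,\zeta]}$, $\{l^2_\xi,l^2_\zeta\}=\{l^3_\xi,l^3_\zeta\}=-l^1_{[\xi,\zeta]}$, $\{l^2_\xi,l^3_\zeta\}=-\{l^3_\xi,l^2_\zeta\}=A_{\xi,\zeta}$. With $\sigma(a_1,a_2,a_3)=(a_3,a_1,a_2)$, put $\pi_2=\sigma_*\pi_1$, $\pi_3=\sigma_*\pi_2$. It is known (Xu) that $\pi_1,\pi_2,\pi_3$ are Poisson with the same symplectic leaves, and that each leaf with the induced symplectic forms $\omega_1,\omega_2,\omega_3$ (with $\omega_i^\flat$ the inverse of $\pi_i^\sharp$ along the leaf, where $\langle\omega^\flat(X),Y\rangle=\omega(X,Y)$, $\langle\pi^\sharp(\alpha),\beta\rangle=\pi(\alpha,\beta)$) is hypersymplectic. A hypersymplectic structure on a manifold is a triple of symplectic forms with $[(\omega_i^\flat)^{-1}\omega_j^\flat]^2=-\mathrm{id}$ for $i\ne j$; its (pseudo-)metric is $g^\flat=\omega_3^\flat(\omega_1^\flat)^{-1}\omega_2^\flat$, and it is hyperkähler if $g$ is positive definite. A diffeomorphism $F:(\tilde M,\tilde\omega_\bullet)\to(M,\omega_\bullet)$ is an isomorphism if $F^*(\omega_1,\omega_2,\omega_3)=(\tilde\omega_1,\tilde\omega_2,\tilde\omega_3)O$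 (row vector times matrix) for some $O\in\mathrm{SO}(3)$, and an anti-isomorphism if this holds for some $O\in\mathrm{O}(3)$ with $\det O=-1$. For $q,r\ge0$, $N_{q,r}$ is the leaf of all $(a_1,a_2,a_3)$ with $\langle a_i,a_j\rangle=0$ for $i\ne j$, $\langle a_1,a_1\rangle-\langle a_2,a_2\rangle=q$, $\langle a_2,a_2\rangle-\langle a_3,a_3\rangle=r$ and $\Phi<0$. On a leaf, the metric is positive definite if the leaf lies in $\mathfrak{su}(2)^3_-$ and negative definite if it lies in $\mathfrak{su}(2)^3_+$. *)

(* Defs.v *)
From Stdlib Require Import Relation_Operators.
From HB Require Import structures.
From mathcomp Require Import all_boot all_order all_algebra.
From mathcomp Require Import all_classical all_reals all_analysis.
From mathcomp Require Import complex.
From mathcomp Require Import ring lra.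
Set Implicit Arguments.
Unset Strict Implicit.
Unset Printing Implicit Defensive.
Import Order.TTheory GRing.Theory Num.Theory.
Import numFieldNormedType.Exports.
Local Open Scope classical_set_scope.
Local Open Scope ring_scope.

Lemma ord2P (i : 'I_2) : i = 0 \/ i = 1.
Proof. by case: i => [[|[|//]] h]; [left|right]; apply/val_inj. Qed.

Lemma ord3P (i : 'I_3) : [\/ i = 0, i = 1 | i = 2%:R].
Proof.
by case: i => [[|[|[|//]]] h]; [constructor 1|constructor 2|constructor 3];
  apply/val_inj.
Qed.

Lemma sum2 (V : nmodType) (F : 'I_2 -> V) : \sum_i F i = F 0 + F 1.
Proof.
by rewrite !big_ord_recl big_ord0 addr0; congr (_ + F _); apply/val_inj.
Qed.

Lemma sum3 (V : nmodType) (F : 'I_3 -> V) : \sum_i F i = F 0 + F 1 + F 2%:R.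
Proof.
rewrite !big_ord_recl big_ord0 addr0 addrA.
by congr (_ + F _ + F _); apply/val_inj.
Qed.

Section Su2.
Variable R : realType.
Implicit Types (u v w : 'rV[R]_3) (M : 'M[R[i]]_2).

Definition is_su2 M : Prop := (map_mx conjc M)^T = - M /\ \tr M = 0.

(* u |-> sum_k u_k e_k with e_k = - (i/2) sigma_k (Pauli matrices) *)
Definition su2mx u : 'M[R[i]]_2 :=
  \matrix_(i, j)
    if i == 0 then
      if j == 0 then Complex 0 (- (u 0 2%:R / 2))
      else Complex (- (u 0 1 / 2)) (- (u 0 0 / 2))
    else
      if j == 0 then Complex (u 0 1 / 2) (- (u 0 0 / 2))
      else Complex 0 (u 0 2%:R / 2).

(* Coordinates in the basis e_1, e_2, e_3; only meaningful on su(2) *)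
Definition su2coord M : 'rV[R]_3 :=
  \row_k (if k == 0 then - 2 * complex.Im (M 0 1)
          else if k == 1 then 2 * complex.Re (M 1 0)
          else 2 * complex.Im (M 1 1)).

End Su2.

HB.lock Definition inner (R : realType) (u v : 'rV[R]_3) : R :=
  complex.Re (- 2 * \tr (su2mx u *m su2mx v)).

HB.lock Definition bracket (R : realType) (u v : 'rV[R]_3) : 'rV[R]_3 :=
  su2coord (su2mx u *m su2mx v - su2mx v *m su2mx u).

Section Su2Theory.
Variable R : realType.
Implicit Types (u v w : 'rV[R]_3) (M : 'M[R[i]]_2).

Lemma su2mx_su2 u : is_su2 (su2mx u).
Proof.
split; last first.
  rewrite /mxtrace sum2 !mxE /=; apply/eqP; rewrite eq_complex /=.
  by rewrite addr0 addNr !eqxx.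
by apply/matrixP => i j; rewrite !mxE;
  case: (ord2P i) => ->; case: (ord2P j) => -> /=;
  apply/eqP; rewrite eq_complex /= ?oppr0 ?opprK !eqxx.
Qed.

Lemma su2mxK : cancel (@su2mx R) (@su2coord R).
Proof.
move=> u; apply/rowP => k; rewrite !mxE.
by case: (ord3P k) => -> /=; field.
Qed.

Lemma su2coordK M : is_su2 M -> su2mx (su2coord M) = M.
Proof.
case=> /matrixP h ht.
have := h 0 0; have := h 0 1; have := h 1 1; move: ht.
rewrite /mxtrace sum2 !mxE.
case E00: (M 0 0) => [a b]; case E01: (M 0 1) => [c d].
case E10: (M 1 0) => [e f]; case E11: (M 1 1) => [g l].
move=> /eqP; rewrite eq_complex /= => /andP[/eqP hr /eqP hi].
move=> /eqP; rewrite eq_complex /= => /andP[/eqP h1 _].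
move=> /eqP; rewrite eq_complex /= => /andP[/eqP h2 /eqP h3].
move=> /eqP; rewrite eq_complex /= => /andP[/eqP h4 _].
have a0 : a = 0 by lra.
have g0 : g = 0 by lra.
apply/matrixP => i j; rewrite !mxE.
by case: (ord2P i) => ->; case: (ord2P j) => -> /=;
  rewrite ?E00 ?E01 ?E10 ?E11 /=; congr Complex; lra.
Qed.

Lemma su2mx_bracket u v :
  su2mx (bracket u v) = su2mx u *m su2mx v - su2mx v *m su2mx u.
Proof.
rewrite bracket.unlock; apply: su2coordK; split; last first.
  by rewrite raddfB /= mxtrace_mulC subrr.
by apply/matrixP => i j; rewrite !(mxE, sum2);
  case: (ord2P i) => ->; case: (ord2P j) => -> /=;
  apply/eqP; rewrite eq_complex /=; apply/andP; split; apply/eqP; ring.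
Qed.

Lemma innerE u v : inner u v = \sum_k u 0 k * v 0 k.
Proof.
rewrite sum3 unlock /mxtrace !(sum2, mxE) /=.
by field.
Qed.

Lemma bracketE u v : bracket u v =
  \row_k (u 0 (k + 1) * v 0 (k + 2%:R) - u 0 (k + 2%:R) * v 0 (k + 1)).
Proof.
apply/rowP => k; rewrite unlock !(sum2, mxE) /=.
have e12 : 1 + 2%:R = 0 :> 'I_3 by apply/val_inj.
have e21 : 2%:R + 1 = 0 :> 'I_3 by apply/val_inj.
have e11 : 1 + 1 = 2%:R :> 'I_3 by apply/val_inj.
have e22 : 2%:R + 2%:R = 1 :> 'I_3 by apply/val_inj.
by case: (ord3P k) => -> /=; rewrite ?add0r ?e12 ?e21 ?e11 ?e22; field.
Qed.

Lemma inner_linearr u c v w : inner u (c *: v + w : 'rV[R]_3) = c * inner u v + inner u w.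
Proof.
rewrite !innerE mulr_sumr -big_split; apply: eq_bigr => k _.
by rewrite !mxE mulrDr mulrCA.
Qed.

Lemma innerC u v : inner u v = inner v u.
Proof. by rewrite !innerE; apply: eq_bigr => k _; rewrite mulrC. Qed.

Lemma inner_linearl u (c : R) v w : inner (c *: v + w) u = c * inner v u + inner w u.
Proof. by rewrite innerC inner_linearr !(innerC u). Qed.

Lemma inner0l u : inner 0 u = 0.
Proof. by rewrite innerE big1 // => k _; rewrite mxE mul0r. Qed.

Lemma bracketC u v : bracket u v = - bracket v u.
Proof. by rewrite !bracketE; apply/rowP => k; rewrite !mxE; ring. Qed.

Lemma bracket_linearr u c v w :
  bracket u (c *: v + w : 'rV[R]_3) = c *: bracket u v + bracket u w.
Proof. by rewrite !bracketE; apply/rowP => k; rewrite !mxE; ring. Qed.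

End Su2Theory.

Section HyperLiePoisson.
Variable R : realType.

(* A point (a_1, a_2, a_3) of su(2)^3 is the matrix with rows a_1, a_2, a_3
   (indices shifted to 0, 1, 2 and cyclic, by the addition of 'I_3). *)
Local Notation E := 'M[R]_3.
Implicit Types (a X Y alpha beta : E) (xi zeta : 'rV[R]_3) (i j k : 'I_3).

Definition Phi a : R := inner (row 0 a) (bracket (row 1 a) (row 2%:R a)).

Definition su2_star : set E := [set a | Phi a != 0].
Definition su2_plus : set E := [set a | 0 < Phi a].
Definition su2_minus : set E := [set a | Phi a < 0].

Definition lfun j xi a : R := inner xi (row j a).

Definition Afun xi zeta a : R :=
  (Phi a)^-1 * \sum_j inner (bracket (row j a) (row (j + 1) a)) xi
                      * inner (bracket (row j a) (row (j + 1) a)) zeta.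

(* {l^j_xi, l^k_zeta} for the first bivector *)
Definition bracket1 j k xi zeta a : R :=
  match nat_of_ord j, nat_of_ord k with
  | 0%N, _ => lfun k (bracket xi zeta) a
  | _, 0%N => lfun j (bracket xi zeta) a
  | 1%N, 1%N => - lfun 0 (bracket xi zeta) a
  | 1%N, _ => Afun xi zeta a
  | _, 1%N => - Afun xi zeta a
  | _, _ => - lfun 0 (bracket xi zeta) a
  end.

(* Covectors on su(2)^3 are identified with elements of su(2)^3 through this
   pairing; thus alpha stands for the sum over j of d l^j_(row j alpha). *)
Definition pair alpha X : R := \sum_j inner (row j alpha) (row j X).

Definition bivector := E -> E -> E -> R.
Implicit Types p : bivector.

Definition pi1 : bivector := fun a alpha beta =>
  \sum_j \sum_k bracket1 j k (row j alpha) (row k beta) a.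

(* sigma (a_1, a_2, a_3) = (a_3, a_1, a_2) *)
Definition sigma a : E := \matrix_(j, k) a (j - 1) k.
Definition sigma_inv a : E := \matrix_(j, k) a (j + 1) k.
Definition sigma_dual alpha : E := \matrix_(j, k) alpha (j + 1) k.

Lemma sigmaK : cancel sigma sigma_inv.
Proof. by move=> a; apply/matrixP => j k; rewrite !mxE addrK. Qed.

Lemma sigma_invK : cancel sigma_inv sigma.
Proof. by move=> a; apply/matrixP => j k; rewrite !mxE subrK. Qed.

Lemma pair_sigma_dual alpha X : pair (sigma_dual alpha) X = pair alpha (sigma X).
Proof.
have e12 : 1 + 1 = 2%:R :> 'I_3 by apply/val_inj.
have e21 : 2%:R + 1 = 0 :> 'I_3 by apply/val_inj.
have e01 : 0 - 1 = 2%:R :> 'I_3 by apply/val_inj.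
have e02 : 2%:R - 1 = 1 :> 'I_3 by apply/val_inj.
by rewrite /pair !(sum3, innerE, mxE) subrr add0r e12 e21 e01 e02; ring.
Qed.

Definition sigma_push p : bivector := fun b alpha beta =>
  p (sigma_inv b) (sigma_dual alpha) (sigma_dual beta).

Definition poisson i : bivector := iter i sigma_push pi1.

(* pi^sharp : pair beta (sharp p a alpha) = p a alpha beta *)
Definition sharp p a alpha : E := \matrix_(j, k) p a alpha (delta_mx j k).

(* For X in the image of pi^sharp at a, a covector alpha with
   pi^sharp alpha = X; its restriction to the image of pi^sharp (the tangent
   space of the leaf), which is omega^flat X, does not depend on the choice. *)
Definition flat p a X : E := xget 0 [set alpha | sharp p a alpha = X].

Definition omega i a X Y : R := pair (flat (poisson i) a X) Y.

(* g^flat = omega_3^flat (omega_1^flat)^-1 omega_2^flat *)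
Definition metric a X Y : R :=
  pair (flat (poisson 2%:R) a
         (sharp (poisson 0) a (flat (poisson 1) a X))) Y.

Lemma bracket1_linear j k xi c (z1 z2 : 'rV[R]_3) a :
  bracket1 j k xi (c *: z1 + z2) a =
  c * bracket1 j k xi z1 a + bracket1 j k xi z2 a.
Proof.
have lL m : lfun m (bracket xi (c *: z1 + z2)) a =
    c * lfun m (bracket xi z1) a + lfun m (bracket xi z2) a.
  by rewrite /lfun bracket_linearr inner_linearl.
have AL : Afun xi (c *: z1 + z2) a = c * Afun xi z1 a + Afun xi z2 a.
  rewrite /Afun [X in _ = X + _]mulrCA -mulrDr; congr (_ * _).
  rewrite mulr_sumr -big_split.
  by apply: eq_bigr => m _; rewrite inner_linearr mulrDr mulrCA.
rewrite /bracket1; case: (nat_of_ord j) (nat_of_ord k) => [|[|?]] [|[|?]];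
  by rewrite ?lL ?AL ?opprD ?mulrN.
Qed.

Lemma bracket1_antisym j k xi zeta a :
  bracket1 j k xi zeta a = - bracket1 k j zeta xi a.
Proof.
have lN m : lfun m (bracket xi zeta) a = - lfun m (bracket zeta xi) a.
  by rewrite /lfun bracketC -scaleN1r -[_ *: _]addr0 inner_linearl inner0l addr0 mulN1r.
have AS : Afun xi zeta a = Afun zeta xi a.
  by rewrite /Afun; congr (_ * _); apply: eq_bigr => m _; rewrite mulrC.
by case: (ord3P j) => ->; case: (ord3P k) => ->; rewrite /bracket1 /=;
  rewrite ?lN ?AS ?opprK.
Qed.

Lemma poisson_linear i a alpha c (X Y : E) :
  poisson i a alpha (c *: X + Y) =
  c * poisson i a alpha X + poisson i a alpha Y.
Proof.
rewrite /poisson; elim: (nat_of_ord i) a alpha X Y => [|n IH] a alpha X Y /=.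
  rewrite /pi1 big_distrr -big_split; apply: eq_bigr => j _ /=.
  rewrite big_distrr -big_split; apply: eq_bigr => k _ /=.
  by rewrite linearP bracket1_linear.
rewrite /sigma_push -IH.
suff -> : sigma_dual (c *: X + Y) = c *: sigma_dual X + sigma_dual Y by [].
by apply/matrixP => j k; rewrite !mxE.
Qed.

Lemma poisson_antisym i a alpha beta :
  poisson i a alpha beta = - poisson i a beta alpha.
Proof.
rewrite /poisson; elim: (nat_of_ord i) a alpha beta => [|n IH] a alpha beta /=.
  rewrite /pi1 exchange_big -sumrN; apply: eq_bigr => j _ /=.
  by rewrite -sumrN; apply: eq_bigr => k _; rewrite bracket1_antisym.
by rewrite /sigma_push IH.
Qed.

Lemma pair_sharp i a alpha beta :
  pair beta (sharp (poisson i) a alpha) = poisson i a alpha beta.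
Proof.
have pD := poisson_linear i a alpha.
pose f : E -> R := poisson i a alpha.
have f0 : f 0 = 0 by have := pD (-1) 0 0; rewrite scaler0 addr0 mulN1r addNr.
have fD : {morph f : x y / x + y}.
  by move=> x y; have := pD 1 x y; rewrite scale1r mul1r.
have fZ c x : f (c *: x) = c * f x.
  by have := pD c x 0; rewrite -[poisson i a alpha 0]/(f 0) f0 !addr0.
rewrite -/(f beta) [in RHS](matrix_sum_delta beta) (big_morph f fD f0).
apply: eq_bigr => j _; rewrite innerE (big_morph f fD f0).
by apply: eq_bigr => k _; rewrite fZ !mxE.
Qed.

Lemma flat_indep i a alpha X beta :
  sharp (poisson i) a alpha = X ->
  omega i a X (sharp (poisson i) a beta) = pair alpha (sharp (poisson i) a beta).
Proof.
move=> h; rewrite /omega !pair_sharp poisson_antisym [RHS]poisson_antisym.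
rewrite -!(pair_sharp i a _ beta) h; congr (- pair _ _).
exact: (@xgetPex _ 0 [set al | sharp (poisson i) a al = X] (ex_intro _ alpha h)).
Qed.

End HyperLiePoisson.

Section Smooth.
Variables (R : realType).

Fixpoint Ck (V W : normedModType R) (n : nat) (U : set V) (f : V -> W) : Prop :=
  match n with
  | 0%N => forall x, U x -> {for x, continuous f}
  | n'.+1 => (forall x, U x -> differentiable f x) /\
             (forall v : V, Ck n' U (fun x => 'd f x v))
  end.

Definition smooth_on (V W : normedModType R) (U : set V) (f : V -> W) : Prop :=
  open U /\ forall n, Ck n U f.

Definition smooth_near (V W : normedModType R) (S : set V) (f : V -> W) : Prop :=
  exists2 U : set V, S `<=` U & smooth_on U f.

(* Tangent vectors to a submanifold S at a: velocities of smooth curves in S *)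
Definition tangent (V : normedModType R) (S : set V) (a X : V) : Prop :=
  exists (I : set R) (c : R -> V),
    [/\ smooth_on I c, I 0, (forall t, I t -> S (c t)), c 0 = a
      & 'd c 0 (1 : R) = X].

End Smooth.

Section Leaves.
Variable R : realType.
Local Notation E := 'M[R]_3.
Implicit Types (L M : set E) (p : bivector R).

Definition differential (H : E -> R) (a : E) : E :=
  \matrix_(j, k) 'd H a (delta_mx j k).

Lemma pair_differential (H : E -> R) (a X : E) :
  differentiable H a -> pair (differential H a) X = 'd H a X.
Proof.
move=> dH; rewrite [in RHS](matrix_sum_delta X) linear_sum.
apply: eq_bigr => j _; rewrite innerE linear_sum.
by apply: eq_bigr => k _; rewrite linearZ !mxE mulrC.
Qed.

(* x and y lie on a trajectory of the Hamiltonian vector field of a locally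
   defined smooth function *)
Definition ham_step p M (x y : E) : Prop :=
  exists (U : set E) (H : E -> R) (c : R -> E) (s t : R),
    [/\ U `<=` M, smooth_on U H, s <= t, c s = x & c t = y] /\
    forall r, s <= r <= t ->
      U (c r) /\ is_derive r 1 c (sharp p (c r) (differential H (c r))).

(* The leaves are the classes of points that can be joined by finitely many
   such trajectories. *)
Definition symplectic_leaf p M L : Prop :=
  exists2 x : E, M x & L = [set y | clos_refl_trans E (ham_step p M) x y].

Definition metric_posdef L : Prop :=
  forall a X, L a -> tangent L a X -> X != 0 -> 0 < metric a X X.

Definition metric_negdef L : Prop :=
  forall a X, L a -> tangent L a X -> X != 0 -> metric a X X < 0.

(* F is a diffeomorphism L -> N with
   F^* (omega_1, omega_2, omega_3) = (omega_1, omega_2, omega_3) O *)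
Definition leaf_map (L N : set E) (F : E -> E) (O : 'M[R]_3) : Prop :=
  (exists G : E -> E,
    [/\ smooth_near L F, smooth_near N G,
        (forall a, L a -> N (F a) /\ G (F a) = a)
      & (forall b, N b -> L (G b) /\ F (G b) = b)]) /\
  (forall a X Y j, L a -> tangent L a X -> tangent L a Y ->
     omega j (F a) ('d F a X) ('d F a Y) = \sum_i omega i a X Y * O i j).

Definition isomorphic L N : Prop :=
  exists (F : E -> E) (O : 'M[R]_3),
    [/\ O^T *m O = 1%:M, \det O = 1 & leaf_map L N F O].

Definition anti_isomorphic L N : Prop :=
  exists (F : E -> E) (O : 'M[R]_3),
    [/\ O^T *m O = 1%:M, \det O = -1 & leaf_map L N F O].

Definition Nleaf (q r : R) : set E :=
  [set a | [/\ forall i j, i != j -> inner (row i a) (row j a) = 0,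
      inner (row 0 a) (row 0 a) - inner (row 1 a) (row 1 a) = q,
      inner (row 1 a) (row 1 a) - inner (row 2%:R a) (row 2%:R a) = r
    & Phi a < 0]].

End Leaves.

(* Main.v *)
From Stdlib Require Import Relation_Operators.
From HB Require Import structures.
Require Import Defs.
From mathcomp Require Import all_boot all_order all_algebra.
From mathcomp Require Import all_classical all_reals all_analysis.
From mathcomp Require Import ring lra.
Set Implicit Arguments.
Unset Strict Implicit.
Unset Printing Implicit Defensive.
Import Order.TTheory GRing.Theory Num.Theory.
Import numFieldNormedType.Exports.
Local Open Scope classical_set_scope.
Local Open Scope ring_scope.

(** Let the points of su(2)^3 be the matrices a with rows a_1, a_2, a_3, so that
    Phi a = \det a.

    At a point with Phi a != 0, the image of each pi_i^sharp consists of the X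
    for which X a^T = c + Omega with c a scalar and Omega skew-symmetric.  The
    pair (c, v), v being the axial vector of Omega, is a quaternion, and in this
    coordinate pi_i^sharp is the right multiplication by minus the i-th imaginary
    unit ([sharp_mul_tr]).  Hence, for X = (x0, x) and Y = (y0, y),
      (omega_1, omega_2, omega_3)(X, Y) = - (y0 x - x0 y + [x, y]) / Phi a,
      g(X, Y) = - (x0 y0 + <x, y>) / Phi a
    ([omegaE], [metricE]), which gives the sign of the metric.

    The condition X a^T in R + so(3) says that the Gram matrix a a^T varies by a
    multiple of the identity.  So a Hamiltonian trajectory stays in the set of
    all b such that b b^T - a a^T is scalar and Phi b has the sign of Phi a
    ([ham_step_level]).  Conversely this whole set is reached
    ([same_level_reach]): linear Hamiltonians generate the rotations
    a |-> a Q, which act transitively on the points with a given Gram matrix and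
    a given sign of Phi, and an explicit rational Hamiltonian moves along the
    curve e P (D + t)^(1/2), where a a^T = P D P^T.

    Finally, diagonalize the Gram matrix of a point of the leaf by a rotation P,
    with decreasing eigenvalues D.  The left multiplication by P^T makes the rows
    orthogonal with squared lengths decreasing, and it conjugates Omega by P,
    that is, it rotates the axial vectors and the triple (omega_1, omega_2,
    omega_3) by P.  If Phi < 0 this is the isomorphism, with O = P.  If Phi > 0,
    then a |-> - P^T a has values in the region Phi < 0 and the same effect on
    the coordinates (c, v), while the factor 1 / Phi changes its sign: so
    O = - P, of determinant -1 ([signed_rotation_leaf_map]). *)

(** * Arithmetic of indices modulo 3 *)

Section Ord3.
Lemma ord3_add11 : 1 + 1 = 2%:R :> 'I_3. Proof. exact/val_inj. Qed.
Lemma ord3_add12 : 1 + 2%:R = 0 :> 'I_3. Proof. exact/val_inj. Qed.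
Lemma ord3_add21 : 2%:R + 1 = 0 :> 'I_3. Proof. exact/val_inj. Qed.
Lemma ord3_add22 : 2%:R + 2%:R = 1 :> 'I_3. Proof. exact/val_inj. Qed.
Lemma ord3_opp1 : - 1 = 2%:R :> 'I_3. Proof. exact/val_inj. Qed.
Lemma ord3_opp2 : - 2%:R = 1 :> 'I_3. Proof. exact/val_inj. Qed.
Lemma ord3_opp0 : - 0 = 0 :> 'I_3. Proof. exact/val_inj. Qed.
Definition ord3N := (ord3_opp0, ord3_opp1, ord3_opp2).
Definition ord3E := (@add0r 'I_3, @addr0 'I_3, ord3_add11, ord3_add12, ord3_add21, ord3_add22).
End Ord3.

Ltac cases3 := repeat match goal with i : 'I_3 |- _ =>
   case: (ord3P i) => -> {i} end; rewrite ?ord3E //=.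
Ltac mx3 := apply/matrixP => ? ?; rewrite ?(mxE, sum3) /=; cases3;
  rewrite ?(mulr0n, mulr1n).

(** * Quaternion coordinates *)

Section Algebra.
Variable R : realType.
Local Notation E := 'M[R]_3.
Implicit Types (a b X Y M P Q alpha beta : E) (u v w : 'rV[R]_3) (c : R) (i j k : 'I_3).

(** The cofactor matrix, whose rows are the cross products [a_2, a_3],
    [a_3, a_1], [a_1, a_2]; it stands for Phi a times the inverse of a^T. *)
Definition cof a : E := \matrix_(j, k)
  (a (j + 1) (k + 1) * a (j + 2%:R) (k + 2%:R) -
   a (j + 1) (k + 2%:R) * a (j + 2%:R) (k + 1)).

(** The sign is such that the row vector w *m skew v is the cross product of v
    and w. *)
Definition skew v : E := \matrix_(j, k)
  (if k == j + 1 then v 0 (j + 2%:R) else if k == j + 2%:R then - v 0 (j + 1) else 0).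

(** The quaternion c + v, as the sum of a scalar and a skew-symmetric matrix. *)
Definition qmx c v : E := c%:M + skew v.

(** Twice the axial vector of the skew-symmetric part. *)
Definition vpart M : 'rV[R]_3 := \row_k (M (k + 1) (k + 2%:R) - M (k + 2%:R) (k + 1)).

Definition axis i : 'rV[R]_3 := delta_mx 0 i.

Lemma inner3 u v : inner u v = u 0 0 * v 0 0 + u 0 1 * v 0 1 + u 0 2%:R * v 0 2%:R.
Proof. by rewrite innerE sum3. Qed.
Lemma bracket_0 u v : bracket u v 0 0 = u 0 1 * v 0 2%:R - u 0 2%:R * v 0 1.
Proof. by rewrite bracketE mxE !ord3E. Qed.
Lemma bracket_1 u v : bracket u v 0 1 = u 0 2%:R * v 0 0 - u 0 0 * v 0 2%:R.
Proof. by rewrite bracketE mxE !ord3E. Qed.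
Lemma bracket_2 u v : bracket u v 0 2%:R = u 0 0 * v 0 1 - u 0 1 * v 0 0.
Proof. by rewrite bracketE mxE !ord3E. Qed.
Definition coord3E := (inner3, bracket_0, bracket_1, bracket_2).

Lemma mulmx_trE (A B : E) j k : (A *m B^T) j k = inner (row j A) (row k B).
Proof. by rewrite innerE mxE; apply: eq_bigr => l _; rewrite !mxE. Qed.

Lemma Phi_expand a : Phi a =
  a 0 0 * (a 1 1 * a 2%:R 2%:R - a 1 2%:R * a 2%:R 1)
  + a 0 1 * (a 1 2%:R * a 2%:R 0 - a 1 0 * a 2%:R 2%:R)
  + a 0 2%:R * (a 1 0 * a 2%:R 1 - a 1 1 * a 2%:R 0).
Proof. by rewrite /Phi bracketE innerE sum3 !mxE ?ord3E. Qed.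

Lemma Phi_det a : Phi a = \det a.
Proof.
have l01 : lift 0 (0 : 'I_2) = 1 :> 'I_3 by exact/val_inj.
have l02 : lift 0 (1 : 'I_2) = 2%:R :> 'I_3 by exact/val_inj.
have l10 : lift 1 (0 : 'I_2) = 0 :> 'I_3 by exact/val_inj.
have l12 : lift 1 (1 : 'I_2) = 2%:R :> 'I_3 by exact/val_inj.
have l20 : lift 2%:R (0 : 'I_2) = 0 :> 'I_3 by exact/val_inj.
have l21 : lift 2%:R (1 : 'I_2) = 1 :> 'I_3 by exact/val_inj.
have m0 : lift 0 (0 : 'I_1) = 1 :> 'I_2 by exact/val_inj.
have m1 : lift 1 (0 : 'I_1) = 0 :> 'I_2 by exact/val_inj.
rewrite Phi_expand (expand_det_row _ 0) sum3 /cofactor.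
rewrite !(expand_det_row _ 0) !sum2 /cofactor !det_mx11 !mxE /=.
rewrite ?(l01, l02, l10, l12, l20, l21, m0, m1).
rewrite ?(l01, l02, l10, l12, l20, l21, m0, m1) /= ?expr0 ?expr1 ?sqrrN.
ring.
Qed.

Lemma mul_cof_tr a : cof a *m a^T = (Phi a)%:M.
Proof. by rewrite Phi_expand; mx3; ring. Qed.

Lemma mul_tr_cof a : (cof a)^T *m a = (Phi a)%:M.
Proof. by rewrite Phi_expand; mx3; ring. Qed.

Lemma cof_tr a : cof a^T = (cof a)^T.
Proof. by apply/matrixP => j k; rewrite !mxE; ring. Qed.

Lemma skew_conj P v : P^T *m skew v *m P = skew (v *m cof P).
Proof. by mx3; ring. Qed.

Lemma qmx_conj P c v : P^T *m P = 1%:M ->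
  P^T *m qmx c v *m P = qmx c (v *m cof P).
Proof.
move=> PP; rewrite mulmxDr mulmxDl mul_mx_scalar -scalemxAl PP scalemx1.
by rewrite skew_conj.
Qed.

Lemma vpart_conj M P : vpart (P^T *m M *m P) = vpart M *m cof P.
Proof. by apply/rowP => ?; rewrite !(mxE, sum3) /=; cases3; ring. Qed.

Lemma bracket_mulmx u v P : bracket (u *m P) (v *m P) = bracket u v *m cof P.
Proof. by apply/rowP => ?; rewrite !(bracketE, mxE, sum3) /=; cases3; ring. Qed.

Lemma cof_mul a b : cof (a *m b) = cof a *m cof b.
Proof. by mx3; ring. Qed.

(** A rotation is its own inverse transpose; by [bracket_mulmx] it therefore
    preserves cross products. *)
Lemma cof_rotation P : P^T *m P = 1%:M -> \det P = 1 -> cof P = P.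
Proof.
move=> PP dP; rewrite -[LHS]mulmx1 -PP mulmxA mul_cof_tr Phi_det dP.
by rewrite mul1mx.
Qed.

Lemma vpart_qmx c v : vpart (qmx c v) = 2 *: v.
Proof. by apply/rowP => ?; rewrite !mxE /=; cases3; ring. Qed.

Lemma trace_qmx c v : \tr (qmx c v) = 3 * c.
Proof. by rewrite /mxtrace sum3 !mxE /=; ring. Qed.

Lemma qmx_inj c v c' v' : qmx c v = qmx c' v' -> c = c' /\ v = v'.
Proof.
move=> e; split.
  by have := congr1 (@mxtrace _ _) e; rewrite !trace_qmx; lra.
apply: (@scalerI _ _ (2 : R)); first by rewrite pnatr_eq0.
by rewrite -!(vpart_qmx c) e !vpart_qmx.
Qed.

(** The pullback by the i-th power of the cyclic permutation sigma; see
    [poissonE]. *)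
Definition cycle_rows i a : E := \matrix_(j, k) a (j + i) k.

Lemma poissonE i a alpha beta :
  poisson i a alpha beta = pi1 (cycle_rows i a) (cycle_rows i alpha) (cycle_rows i beta).
Proof.
have s0 (x : E) : cycle_rows 0 x = x by apply/matrixP => j k; rewrite mxE addr0.
case: (ord3P i) => ->; rewrite /poisson /= /sigma_push ?s0 //.
congr (pi1 _ _ _); apply/matrixP => j k; rewrite !mxE -addrA; congr (_ _ k);
  exact/val_inj.
Qed.

(** The part of pi_1^sharp that comes from the brackets linear in a. *)
Definition linear_part a alpha : E := \matrix_(j, k)
  (if j == 0 then \sum_m bracket (row m a) (row m alpha) 0 k
   else bracket (row j a) (row 0 alpha) 0 k - bracket (row 0 a) (row j alpha) 0 k).

(** The brackets given by Afun couple the components 2 and 3 only; this matrix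
    records that coupling.  See [sharp_pi1]. *)
Definition quadratic_part alpha : E := \matrix_(j, k)
  (if j == 0 then 0 else if j == 1 then - alpha 2%:R k else alpha 1 k).

Lemma row_delta j k (m : 'I_3) : row m (delta_mx j k : E) = (m == j)%:R *: axis k.
Proof. by apply/rowP => l; rewrite !mxE /= -natrM mulnb. Qed.

Lemma bracket_row a j : bracket (row j a) (row (j + 1) a) = row (j + 2%:R) (cof a).
Proof. by apply/rowP => k; rewrite bracketE !mxE; cases3; ring. Qed.

Lemma inner_axis i v : inner (axis i) v = v 0 i.
Proof. by rewrite innerE sum3 !mxE; cases3; ring. Qed.

Lemma bracket1_scale j k (xi z : 'rV[R]_3) c (a : E) :
  bracket1 j k xi (c *: z) a = c * bracket1 j k xi z a.
Proof.
have := bracket1_linear j k xi (-1) 0 0 a; rewrite scaler0 addr0 mulN1r addNr => z0.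
by have := bracket1_linear j k xi c z 0 a; rewrite !addr0 z0 addr0.
Qed.

Lemma sharp_pi1_entry (a alpha : E) j k :
  sharp (@pi1 R) a alpha j k = \sum_m bracket1 m j (row m alpha) (axis k) a.
Proof.
rewrite mxE; apply: eq_bigr => m _; rewrite (bigD1 j) //= big1 => [|l lj].
  by rewrite row_delta eqxx scale1r addr0.
by rewrite row_delta (negbTE lj) bracket1_scale mul0r.
Qed.

Lemma inner_bracket_axis k (u w : 'rV[R]_3) : inner w (bracket u (axis k)) = bracket w u 0 k.
Proof. by case: (ord3P k) => ->; rewrite !(coord3E, mxE) /=; ring. Qed.

Lemma Afun_axis (a : E) (xi : 'rV[R]_3) k :
  Afun xi (axis k) a = (Phi a)^-1 * (xi *m (cof a)^T *m cof a) 0 k.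
Proof.
rewrite /Afun sum3 !bracket_row ![inner _ (axis k)]innerC !inner_axis ?ord3E.
by congr (_ * _); rewrite !(coord3E, mxE, sum3); ring.
Qed.

Lemma sharp_pi1 (a alpha : E) : sharp (@pi1 R) a alpha =
  linear_part a alpha + (Phi a)^-1 *: (quadratic_part alpha *m (cof a)^T *m cof a).
Proof.
rewrite -mulmxA; set N := _ *m cof a.
have AE m k : Afun (row m alpha) (axis k) a = (Phi a)^-1 * (alpha *m N) m k.
  by rewrite Afun_axis -mulmxA -row_mul mxE.
clearbody N; have qE k : [/\ (quadratic_part alpha *m N) 0 k = 0,
    (quadratic_part alpha *m N) 1 k = - (alpha *m N) 2%:R k
  & (quadratic_part alpha *m N) 2%:R k = (alpha *m N) 1 k].
  by split; rewrite !(mxE, sum3) /=; ring.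
apply/matrixP => j k; rewrite sharp_pi1_entry sum3 /bracket1 /lfun.
rewrite ![inner (bracket _ _) _]innerC !inner_bracket_axis !AE.
have [q0 q1 q2] := qE k; rewrite [RHS]mxE [X in _ = X + _]mxE [X in _ = _ + X]mxE.
by case: (ord3P j) => ->; rewrite /= ?sum3 ?q0 ?q1 ?q2; ring.
Qed.

(** The case of pi_1 of [sharp_mul_tr]: every entry is a combination of triple
    products of the rows of x and y. *)
Lemma sharp_pi1_quat (x y : E) (c := y *m (cof x)^T) :
    linear_part x y *m x^T + quadratic_part y *m (cof x)^T =
    qmx (vpart c 0 0) (bracket (axis 0) (vpart c) - \tr c *: axis 0).
Proof.
have cE j k : c j k = inner (row j y) (row k (cof x)) by exact: mulmx_trE.
have l0 : row 0 (linear_part x y) = bracket (row 0 x) (row 0 y) +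
    bracket (row 1 x) (row 1 y) + bracket (row 2%:R x) (row 2%:R y).
  by apply/rowP => k; rewrite !mxE /= sum3.
have l1 : row 1 (linear_part x y) = bracket (row 1 x) (row 0 y) - bracket (row 0 x) (row 1 y).
  by apply/rowP => k; rewrite !mxE.
have l2 : row 2%:R (linear_part x y) =
    bracket (row 2%:R x) (row 0 y) - bracket (row 0 x) (row 2%:R y).
  by apply/rowP => k; rewrite !mxE.
have q0 : row 0 (quadratic_part y) = 0 by apply/rowP => k; rewrite !mxE.
have q1 : row 1 (quadratic_part y) = - row 2%:R y by apply/rowP => k; rewrite !mxE.
have q2 : row 2%:R (quadratic_part y) = row 1 y by apply/rowP => k; rewrite !mxE.
have k0 : row 0 (cof x) = bracket (row 1 x) (row 2%:R x)
  by have := bracket_row x 1; rewrite !ord3E.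
have k1 : row 1 (cof x) = bracket (row 2%:R x) (row 0 x)
  by have := bracket_row x 2%:R; rewrite !ord3E.
have k2 : row 2%:R (cof x) = bracket (row 0 x) (row 1 x)
  by have := bracket_row x 0; rewrite !ord3E.
apply/matrixP => j k; rewrite [LHS]mxE !mulmx_trE /mxtrace sum3 {1}/qmx mxE.
clearbody c.
by case: (ord3P j) => ->; case: (ord3P k) => ->;
  rewrite !mxE /= ?ord3E ?(bracket_0, bracket_1, bracket_2) ?mxE ?ord3E
    ?(cE, l0, l1, l2, q0, q1, q2, k0, k1, k2);
  move: (row 0 x) (row 1 x) (row 2%:R x) (row 0 y) (row 1 y) (row 2%:R y) => x0 x1 x2 y0 y1 y2;
  rewrite !(coord3E, mxE) /= ?mulr1n ?mulr0n; ring.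
Qed.

Lemma qmx_cycle i c (v w : 'rV[R]_3) : (forall l, v 0 (l - i) = w 0 l) ->
  forall j k, qmx c v (j - i) (k - i) = qmx c w j k.
Proof.
move=> vw j k; rewrite !mxE !(addrAC _ (- i)) !vw.
by rewrite !(inj_eq (addIr _)).
Qed.

(** Permuting the indices of b cyclically permutes the components of its axial
    vector; this transports the formula for pi_1 to the other two structures. *)
Lemma quat_cycle i (b b' : E) (h4 : forall j k, b' j k = b (j + i) (k + i)) j k :
   qmx (vpart b' 0 0) (bracket (axis 0) (vpart b') - \tr b' *: axis 0) (j - i) (k - i) =
   qmx (vpart b 0 i) (bracket (axis i) (vpart b) - \tr b *: axis i) j k.
Proof.
have vE l : vpart b' 0 l = vpart b 0 (l + i).
  by rewrite !mxE !h4 ![l + _ + i]addrAC.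
have tE : \tr b' = \tr b.
  by rewrite /mxtrace !sum3 !h4; case: (ord3P i) => ->; rewrite !ord3E; ring.
rewrite vE add0r tE; apply: qmx_cycle => l; rewrite !bracketE; move: vE.
move: (vpart b) (vpart b') (\tr b) => v v' t vE.
rewrite !mxE !vE !(addrAC l (- i)) !subrK.
by case: (ord3P i) => ->; case: (ord3P l) => ->; rewrite ?ord3E ?ord3N ?ord3E /=; ring.
Qed.

(** The central computation.  Only the trace and the axial vector of
    b = alpha (cof a)^T matter, i.e. the covector modulo those that vanish on the
    leaf; on the quaternion (\tr b, vpart b) the map pi_i^sharp is the right
    multiplication by the imaginary unit - axis i.  The cyclic permutation of the rows
    reduces the statement to pi_1, where the matrix cof a *m a^T = Phi a
    cancels the denominator of Afun. *)
Lemma sharp_mul_tr i a alpha b : Phi a != 0 -> alpha *m (cof a)^T = b ->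
  sharp (poisson i) a alpha *m a^T =
  qmx (vpart b 0 i) (bracket (axis i) (vpart b) - \tr b *: axis i).
Proof.
move=> a0 bE.
have h1 (x y : E) : Phi x != 0 -> sharp (@pi1 R) x y *m x^T =
   linear_part x y *m x^T + quadratic_part y *m (cof x)^T.
  move=> x0; rewrite sharp_pi1 mulmxDl -scalemxAl -!mulmxA mul_cof_tr.
  by rewrite !mul_mx_scalar -scalemxAr scalerA mulVf // scale1r.
have PhiS : Phi (cycle_rows i a) = Phi a.
  by rewrite !Phi_expand !mxE; cases3; ring.
have h2 j k : (sharp (poisson i) a alpha *m a^T) j k =
    (sharp (@pi1 R) (cycle_rows i a) (cycle_rows i alpha) *m (cycle_rows i a)^T) (j - i) (k - i).
  rewrite !mxE; apply: eq_bigr => l _; rewrite !mxE subrK poissonE.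
  congr (pi1 _ _ _ * _); apply/matrixP => j' k'; rewrite !mxE.
  by rewrite [in RHS]eq_sym subr_eq eq_sym.
(* permuting the rows of a and of alpha permutes the indices of b *)
have h4 j k : (cycle_rows i alpha *m (cof (cycle_rows i a))^T) j k = b (j + i) (k + i).
  rewrite -bE !mxE; apply: eq_bigr => l _; rewrite !mxE.
  by rewrite ![k + _ + i]addrAC.
apply/matrixP => j k; rewrite h2 h1 ?PhiS // sharp_pi1_quat.
exact: quat_cycle.
Qed.

(** * The induced symplectic forms and the metric *)

Lemma mul_tr_inj a X Y : Phi a != 0 -> X *m a^T = Y *m a^T -> X = Y.
Proof.
move=> a0 /(congr1 (mulmx^~ (cof a))); rewrite -!mulmxA.
have -> : a^T *m cof a = (Phi a)%:M.
  by rewrite -[LHS]trmxK trmx_mul trmxK mul_tr_cof tr_scalar_mx.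
by rewrite !mul_mx_scalar => /(scalerI a0).
Qed.

(** Every b is the b of some covector in [sharp_mul_tr]. *)
Lemma mul_cof_trI a b : Phi a != 0 -> ((Phi a)^-1 *: (b *m a)) *m (cof a)^T = b.
Proof.
move=> a0; rewrite -scalemxAl -mulmxA -[a *m _]trmxK trmx_mul trmxK mul_cof_tr.
by rewrite tr_scalar_mx mul_mx_scalar scalerA mulVf // scale1r.
Qed.

Lemma pairE alpha X : pair alpha X = \tr (alpha *m X^T).
Proof.
rewrite /pair /mxtrace; apply: eq_bigr => j _; rewrite innerE mxE.
by apply: eq_bigr => k _; rewrite !mxE.
Qed.

(** An imaginary unit squares to -1, so that the right multiplication by axis i
    inverts the map of [sharp_mul_tr]. *)
Lemma quat_sharpK i c v :
  let p := c *: axis i - bracket (axis i) v in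
  p 0 i = c /\ bracket (axis i) p + v 0 i *: axis i = v.
Proof.
split; first by rewrite !(bracketE, mxE); cases3; ring.
apply/rowP => ?; rewrite !(bracketE, mxE); cases3; ring.
Qed.

(** An explicit covector representing omega_i^flat X. *)
Lemma flat_exists i a X c v : Phi a != 0 -> X *m a^T = qmx c v ->
  let b := qmx (- v 0 i / 3) (2^-1 *: (c *: axis i - bracket (axis i) v)) in
  sharp (poisson i) a ((Phi a)^-1 *: (b *m a)) = X.
Proof.
move=> a0 eX b; apply: (mul_tr_inj a0).
rewrite (sharp_mul_tr i a0 (mul_cof_trI b a0)) eX vpart_qmx trace_qmx.
rewrite scalerA divff ?pnatr_eq0 // scale1r.
have [-> e] := quat_sharpK i c v; congr qmx.
by rewrite mulrCA divff ?pnatr_eq0 // mulr1 scaleNr opprK.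
Qed.

Lemma trace_qmx_tr c (u : 'rV[R]_3) c' v :
  \tr (qmx c u *m (qmx c' v)^T) = 3 * (c * c') + 2 * inner u v.
Proof.
rewrite /mxtrace sum3 !mulmx_trE !inner3 !mxE /= ?ord3E ?mulr1n ?mulr0n; ring.
Qed.

(** By independence of the choice made in [flat], the covector of [flat_exists]
    computes omega_i; the pairing of quaternions is the Euclidean one. *)
Lemma omegaE i a X Y x0 x y0 y : Phi a != 0 ->
  X *m a^T = qmx x0 x -> Y *m a^T = qmx y0 y ->
  omega i a X Y = - (Phi a)^-1 * (y0 *: x - x0 *: y + bracket x y) 0 i.
Proof.
move=> a0 eX eY; have fX := flat_exists i a0 eX; have fY := flat_exists i a0 eY.
rewrite -[in LHS]fY (flat_indep _ fX) fY pairE -scalemxAl mxtraceZ.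
rewrite -mulmxA -[a *m _]trmxK trmx_mul trmxK eY trace_qmx_tr.
rewrite [RHS]mulNr -[RHS]mulrN; congr (_ * _).
by case: (ord3P i) => ->; rewrite !(coord3E, mxE) /=; field.
Qed.

(** g^flat = omega_3^flat pi_1^sharp omega_2^flat, and the product of the three
    imaginary units involved is -1. *)
Lemma metricE a X Y x0 x y0 y : Phi a != 0 ->
  X *m a^T = qmx x0 x -> Y *m a^T = qmx y0 y ->
  metric a X Y = - (Phi a)^-1 * (x0 * y0 + inner x y).
Proof.
move=> a0 eX eY; set al := flat (poisson 1) a X.
have eal : sharp (poisson 1) a al = X.
  apply: (@xgetPex _ 0 [set al | sharp (poisson 1) a al = X]).
  by eexists; exact: (flat_exists 1 a0 eX).
rewrite -[metric a X Y]/(omega 2%:R a (sharp (poisson 0) a al) Y).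
(* the covector al is only known through its image X by pi_2^sharp, which
   determines its quaternion, hence its image by pi_1^sharp *)
have e1 := sharp_mul_tr 1 a0 (erefl (al *m (cof a)^T)).
move: (sharp_mul_tr 0 a0 (erefl (al *m (cof a)^T))).
move: e1; rewrite eal eX; set p := vpart _; set p0 := \tr _.
move=> /qmx_inj[-> ->] eZ; rewrite (omegaE 2%:R a0 eZ eY).
clearbody p p0; congr (_ * _).
by rewrite !(coord3E, mxE) /=; ring.
Qed.

End Algebra.

(** * Diagonalization of symmetric 3 x 3 matrices by rotations *)

Section SpectralTheorem.
Variable R : realType.
Implicit Types (u v w : 'rV[R]_3) (S : 'M[R]_3).

Lemma inner_mulmx u v M : inner (u *m M) v = inner u (v *m M^T) :> R.
Proof. by rewrite !innerE !sum3 !(mxE, sum3); ring. Qed.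

Lemma innerDl u v w : inner (u + v) w = inner u w + inner v w :> R.
Proof. by rewrite -[u]scale1r inner_linearl mul1r scale1r. Qed.

Lemma innerZl c u w : inner (c *: u) w = c * inner u w :> R.
Proof. by rewrite -[c *: u]addr0 inner_linearl inner0l addr0. Qed.

Lemma innerDr u v w : inner w (u + v) = inner w u + inner w v :> R.
Proof. by rewrite innerC innerDl !(innerC w). Qed.

Lemma innerZr c u w : inner w (c *: u) = c * inner w u :> R.
Proof. by rewrite innerC innerZl (innerC w). Qed.

Lemma inner_ge0 u : 0 <= inner u u :> R.
Proof. by rewrite innerE; apply: sumr_ge0 => k _; rewrite -expr2 sqr_ge0. Qed.

Lemma inner_eq0 u : (inner u u == 0 :> R) = (u == 0).
Proof.
apply/eqP/eqP => [|->]; last exact: inner0l.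
rewrite innerE => /eqP; rewrite psumr_eq0 => [/allP h|k _].
  apply/rowP => k; rewrite mxE; apply/eqP.
  by have := h k (mem_index_enum k); rewrite mulf_eq0 orbb.
by rewrite -expr2 sqr_ge0.
Qed.

Lemma inner_gt0 u : (0 < inner u u :> R) = (u != 0).
Proof. by rewrite lt_def inner_ge0 andbT inner_eq0. Qed.

Lemma inner_bracketl u v : inner u (bracket u v) = 0 :> R.
Proof. by rewrite innerE sum3 bracketE !mxE ?ord3E; ring. Qed.

Lemma inner_bracketr u v : inner v (bracket u v) = 0 :> R.
Proof. by rewrite innerE sum3 bracketE !mxE ?ord3E; ring. Qed.

Lemma inner_bracket2 u v :
  inner (bracket u v) (bracket u v) = inner u u * inner v v - inner u v ^+ 2 :> R.
Proof. by rewrite !innerE !sum3 bracketE !mxE ?ord3E; ring. Qed.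

Lemma inner_normalize u : u != 0 -> inner ((Num.sqrt (inner u u))^-1 *: u)
                                   ((Num.sqrt (inner u u))^-1 *: u) = 1.
Proof.
move=> u0; rewrite innerZl innerZr mulrA -expr2 exprVn sqr_sqrtr ?inner_ge0 //.
by rewrite mulVf // inner_eq0.
Qed.

(** For w with (w_1, w_2) nonzero a quarter turn of (w_1, w_2) is orthogonal to
    w; otherwise the first axis is. *)
Lemma unit_orthogonal w : exists2 u, inner u u = 1 & inner w u = 0.
Proof.
pose v : 'rV[R]_3 := \row_k (if k == 0 then - w 0 1 else if k == 1 then w 0 0 else 0).
have wv : inner w v = 0 by rewrite innerE sum3 !mxE /=; ring.
have [v0|v0] := eqVneq v 0; last first.
  by exists ((Num.sqrt (inner v v))^-1 *: v); [exact: inner_normalize|rewrite innerZr wv mulr0].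
exists (axis R 0); first by rewrite inner_axis mxE.
by have /rowP/(_ 1) := v0; rewrite innerC inner_axis !mxE.
Qed.

Lemma mul_continuous (f g : 'rV[R]_3 -> R) :
  continuous f -> continuous g -> continuous (fun u => f u * g u).
Proof. by move=> cf cg x; apply: (@cvgM _ _ (nbhs x) (nbhs_filter x)); [exact: cf|exact: cg]. Qed.

Lemma sum_continuous n (f : 'I_n -> 'rV[R]_3 -> R) :
  (forall i, continuous (f i)) -> continuous (fun u => \sum_i f i u).
Proof.
move=> cf; rewrite (_ : (fun u => _) = \sum_i f i).
  elim/big_ind: _ => [x|g h cg ch x|i _]; first exact: cst_continuous.
    by apply: continuousD; [exact: cg|exact: ch].
  exact: cf.
by apply/funext => u; rewrite fct_sumE.
Qed.

Lemma quadratic_continuous S : continuous (fun u => inner (u *m S) u).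
Proof.
under eq_fun do rewrite innerE.
apply: sum_continuous => i; apply: mul_continuous; last exact: coord_continuous.
under eq_fun do rewrite mxE.
apply: sum_continuous => j; apply: mul_continuous; first exact: coord_continuous.
exact: cst_continuous.
Qed.

(** Compactness of the unit sphere of the orthogonal of w.  With w = 0 this is
    the whole unit sphere. *)
Lemma quadratic_max S w : exists u, [/\ inner u u = 1, inner w u = 0 &
  forall v, inner w v = 0 -> inner (v *m S) v <= inner (u *m S) u * inner v v].
Proof.
pose A := [set u | inner u u = 1 :> R] `&` [set u | inner w u = 0 :> R].
have A0 : A !=set0 by have [u ? ?] := unit_orthogonal w; exists u.
have cN : continuous (fun u => inner u u : R).
  by under eq_fun do rewrite -[X in inner X _]mulmx1; exact: quadratic_continuous.
have cw : continuous (fun u => inner w u : R).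
  under eq_fun do rewrite innerE.
  apply: sum_continuous => i; apply: mul_continuous; last exact: coord_continuous.
  exact: cst_continuous.
have cA : compact A.
  apply: bounded_closed_compact.
    exists 1; split; first exact: num_real.
    move=> M M1 u [/= u1 _]; rewrite /Num.Def.normr /= mx_normrE.
    apply: bigmax_le => [|[i k] _ /=]; first by rewrite (le_trans _ (ltW M1)).
    apply: le_trans (ltW M1); rewrite -(@ler_pXn2r _ 2) ?nnegrE // expr1n.
    rewrite real_normK ?num_real // (ord1 i) -u1 innerE (bigD1 k) //= -expr2 lerDl.
    by apply: sumr_ge0 => l _; rewrite -expr2 sqr_ge0.
  apply: closedI.
    by apply: (@closed_comp _ _ _ [set 1 : R]) => [u _|]; [exact: cN|exact: closed_eq].
  by apply: (@closed_comp _ _ _ [set 0 : R]) => [u _|]; [exact: cw|exact: closed_eq].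
have [|u uA umax] := EVT_max_rV A0 cA (f := fun u => inner (u *m S) u).
  exact/continuous_subspaceT/quadratic_continuous.
have [u1 wu] : A u by move: uA; rewrite inE.
exists u; split=> // v wv; have [->|v0] := eqVneq v 0.
  by rewrite mul0mx !inner0l mulr0.
pose s := Num.sqrt (inner v v); have s0 : 0 < s by rewrite sqrtr_gt0 inner_gt0.
have /umax : s^-1 *: v \in A.
  by rewrite inE; split; [exact: inner_normalize|rewrite /= innerZr wv mulr0].
rewrite -scalemxAl innerZl innerZr mulrA -expr2 exprVn.
by rewrite -ler_pdivlMl ?invr_gt0 ?exprn_gt0 // invrK sqr_sqrtr ?inner_ge0 // mulrC.
Qed.

(** First-order condition at a maximum: the inequality at x u + z is affine in x,
    with slope twice the value of the bilinear form. *)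
Lemma max_orthogonal S u z : S^T = S -> inner u u = 1 -> inner u z = 0 ->
  (forall x, let v := x *: u + z in
     inner (v *m S) v <= inner (u *m S) u * inner v v) ->
  inner (u *m S) z = 0.
Proof.
move=> sS u1 uz h; apply/eqP/negPn/negP => B0.
set B := inner (u *m S) z in B0; pose K := inner (u *m S) u * inner z z - inner (z *m S) z.
have {}h x : 2 * x * B <= K.
  have := h x; rewrite /= mulmxDl -scalemxAl !(innerDl, innerDr, innerZl, innerZr).
  have -> : inner (z *m S) u = B by rewrite inner_mulmx sS innerC.
  by rewrite -/B u1 (innerC z) uz /K; lra.
(* an affine function of x bounded by K takes the value K + 1 at this point *)
have := h ((K + 1) / (2 * B)).
have -> : 2 * ((K + 1) / (2 * B)) * B = K + 1 by field.
lra.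
Qed.

(** The rows of P^T are a maximizer u of the quadratic form on the sphere, a
    maximizer v on the circle orthogonal to u, and their cross product.  This
    choice orders the eigenvalues and makes P a rotation at the same time. *)
Lemma symmetric_diagonalizable S : S^T = S -> exists (P : 'M[R]_3) (d : 'rV[R]_3),
  [/\ P^T *m P = 1%:M, \det P = 1, S = P *m diag_mx d *m P^T,
      d 0 1 <= d 0 0 & d 0 2%:R <= d 0 1].
Proof.
move=> sS.
have [u [u1 _ umax]] := quadratic_max S 0.
have [v [v1 uv vmax]] := quadratic_max S u.
pose w := bracket u v.
have uw : inner u w = 0 by exact: inner_bracketl.
have vw : inner v w = 0 by exact: inner_bracketr.
have w1 : inner w w = 1 by rewrite inner_bracket2 u1 v1 uv expr0n subr0 mulr1.
have Suv : inner (u *m S) v = 0.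
  by apply: max_orthogonal => // x /=; apply: umax; rewrite inner0l.
have Suw : inner (u *m S) w = 0.
  by apply: max_orthogonal => // x /=; apply: umax; rewrite inner0l.
have Svw : inner (v *m S) w = 0.
  by apply: max_orthogonal => // x /=; apply: vmax; rewrite innerDr innerZr uv uw mulr0 addr0.
pose Q : 'M[R]_3 := \matrix_(j, k) (if j == 0 then u else if j == 1 then v else w) 0 k.
have rQ0 : row 0 Q = u by apply/rowP => k; rewrite !mxE.
have rQ1 : row 1 Q = v by apply/rowP => k; rewrite !mxE.
have rQ2 : row 2%:R Q = w by apply/rowP => k; rewrite !mxE.
have QQ : Q *m Q^T = 1%:M.
  apply/matrixP => j k; rewrite mulmx_trE [in RHS]mxE.
  by case: (ord3P j) => ->; case: (ord3P k) => ->; rewrite ?(rQ0, rQ1, rQ2) /=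
    ?(innerC w) ?(innerC v u) ?u1 ?v1 ?w1 ?uv ?uw ?vw.
pose d := \row_k inner (row k Q *m S) (row k Q).
have QSQ : Q *m S *m Q^T = diag_mx d.
  have sC a b : inner (a *m S) b = inner (b *m S) a by rewrite inner_mulmx sS innerC.
  apply/matrixP => j k; rewrite mulmx_trE row_mul !mxE.
  by case: (ord3P j) => ->; case: (ord3P k) => ->; rewrite ?(rQ0, rQ1, rQ2) /= ?mulr1n ?mulr0n
    // ?Suv ?Suw ?Svw // sC ?Suv ?Suw ?Svw.
exists Q^T, d; split.
- by rewrite trmxK.
- rewrite det_tr -Phi_det /Phi rQ0 rQ1 rQ2.
  have -> : inner u (bracket v w) = inner w (bracket u v).
    by rewrite !innerE !sum3 !bracketE !mxE ?ord3E; ring.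
  exact: w1.
- by rewrite -QSQ trmxK !mulmxA (mulmx1C QQ) mul1mx -mulmxA (mulmx1C QQ) mulmx1.
- rewrite !mxE rQ0 rQ1; have := umax v; rewrite inner0l v1 mulr1; exact.
- by rewrite !mxE rQ1 rQ2; have := vmax w; rewrite w1 mulr1; exact.
Qed.
End SpectralTheorem.

(** * Calculus on matrices *)

Section MatrixCalculus.
Variable R : realType.

(** A linear map is a finite combination of the coordinate functions. *)
Lemma linear_mx_continuous (V : normedModType R) m n (f : {linear 'M[R]_(m, n) -> V}) :
  continuous f.
Proof.
suff H (x : 'M[R]_(m, n)) : {for x, continuous f} by move=> x; exact: H.
have -> : (f : _ -> _) = \sum_i \sum_j (fun y : 'M[R]_(m, n) => y i j *: f (delta_mx i j)).
  apply/funext => y; rewrite [in LHS](matrix_sum_delta y) linear_sum fct_sumE.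
  apply: eq_bigr => i _; rewrite linear_sum fct_sumE.
  by apply: eq_bigr => j _; rewrite linearZ.
elim/big_ind: _ => [|g h cg ch|i _]; [exact: cst_continuous|exact: continuousD|].
elim/big_ind: _ => [|g h cg ch|j _]; [exact: cst_continuous|exact: continuousD|].
apply: (@cvgZr_tmp _ _ _ (nbhs x) (nbhs_filter x)); exact: coord_continuous.
Qed.

Lemma is_derive_mxP m n (c : R -> 'M[R]_(m, n)) (t : R) (X : 'M[R]_(m, n)) :
  is_derive t (1 : R) c X <-> forall i j, is_derive t (1 : R) (fun r => c r i j) (X i j).
Proof.
split=> [h i j|h].
  have dc : derivable c t 1 by exact: ex_derive.
  apply: DeriveDef; first exact: (derivable_mxP c t 1).1.
  by rewrite -(@derive_val _ _ _ _ _ _ _ h) derive_mx // mxE.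
have dc : derivable c t 1 by apply/derivable_mxP => i j; exact: ex_derive.
apply: DeriveDef => //; rewrite derive_mx //; apply/matrixP => i j; rewrite mxE.
exact: derive_val.
Qed.

Lemma near_eq_diff (V W : normedModType R) (f g : V -> W) x :
  (\near x, f x = g x) -> differentiable f x ->
  differentiable g x /\ 'd g x = 'd f x :> (V -> W).
Proof.
move=> fg df; have [cdf ef] := (diff_locallyP x f).1 df.
have eg : g \o shift x = cst (g x) + 'd f x +o_ 0 id.
  apply/eqaddoP => _/posnumP[e]; move/eqaddoP: ef => /(_ e%:num (gt0 e)) ef.
  have gf : \forall y \near 0, f (y + x) = g (y + x).
    by move: fg; rewrite (near_shift 0) /= => H; apply: filterS H => y /=; rewrite subr0.
  have fgx := nbhs_singleton fg.
  apply: filterS2 gf ef => y e1; rewrite /shift !fctE -fgx. by rewrite e1.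
have dg : 'd g x = 'd f x :> (V -> W) by apply: diff_unique.
split; last exact: dg.
apply/diff_locallyP; split; first by rewrite dg; exact: cdf.
by rewrite dg; exact: eg.
Qed.
End MatrixCalculus.

Section SmoothFunctions.
Variable R : realType.
Implicit Types (V W : normedModType R).

(** Functions that agree on an open set have the same differentials there; this
    is what allows one to differentiate formulas valid on U only. *)
Lemma Ck_ext V W n (U : set V) (f g : V -> W) :
  open U -> (forall x, U x -> f x = g x) -> Ck n U f -> Ck n U g.
Proof.
move=> oU; have near_U x (P : V -> Prop) : U x -> (forall y, U y -> P y) -> \near x, P x.
  by move=> Ux UP; apply: filterS UP _; exact: open_nbhs_nbhs.
elim: n f g => [|n IH] f g fg /=.
  move=> cf x Ux; suff : g @ x --> g x by []; rewrite -(fg x Ux).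
  by apply: cvg_trans (cf x Ux); apply: near_eq_cvg; exact: near_U.
case=> df Cf; have dg x : U x -> differentiable g x /\ 'd g x = 'd f x :> (V -> W).
  by move=> Ux; apply: near_eq_diff (df x Ux); exact: near_U.
split=> [x /dg[]//|v]; apply: IH (Cf v) => x /dg[_ ->//].
Qed.

Lemma CkW V W n (U : set V) (f : V -> W) : Ck n.+1 U f -> Ck n U f.
Proof.
elim: n f => [|n IH] f /= [df Cf].
  by move=> x /df; exact: differentiable_continuous.
by split=> // v; apply: IH; exact: Cf.
Qed.

Lemma Ck_cst V W n (U : set V) (w : W) : Ck n U (cst w).
Proof.
elim: n w => [|n IH] w /=; first by move=> x _; exact: cst_continuous.
split=> [x _|v]; first exact: differentiable_cst.
rewrite (_ : (fun x => _) = cst 0); first exact: IH.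
by apply/funext => x; rewrite diff_cst.
Qed.

Lemma Ck_linear V W n (U : set V) (f : {linear V -> W}) : continuous f -> Ck n U f.
Proof.
move=> cf; case: n => [|n] /=; first by move=> x _; exact: cf.
split=> [x _|v]; first exact: linear_differentiable.
rewrite (_ : (fun x => _) = cst (f v)); first exact: Ck_cst.
by apply/funext => x; rewrite diff_lin.
Qed.

Lemma Ck_add V W n (U : set V) (f g : V -> W) :
  open U -> Ck n U f -> Ck n U g -> Ck n U (fun x => f x + g x).
Proof.
move=> oU; elim: n f g => [|n IH] f g /=.
  by move=> cf cg x Ux; apply: cvgD; [exact: cf|exact: cg].
move=> [df Cf] [dg Cg]; split=> [x Ux|v].
  by apply: differentiableD; [exact: df|exact: dg].
apply: Ck_ext (IH _ _ (Cf v) (Cg v)) => // x Ux.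
by have -> : (fun y => f y + g y) = f + g by []; rewrite diffD //; [exact: df|exact: dg].
Qed.

Lemma Ck_mul V n (U : set V) (f g : V -> R) :
  open U -> Ck n U f -> Ck n U g -> Ck n U (fun x => f x * g x).
Proof.
move=> oU; elim: n f g => [|n IH] f g.
  by move=> /= cf cg x Ux; apply: cvgM; [exact: cf|exact: cg].
move=> Cf Cg; have := Cf; have := Cg => -[dg Cg'] [df Cf'].
split=> [x Ux|v]; first by apply: differentiableM; [exact: df|exact: dg].
have := Ck_add oU (IH _ _ (CkW Cf) (Cg' v)) (IH _ _ (CkW Cg) (Cf' v)).
apply: Ck_ext => // x Ux.
by have -> : (fun y => f y * g y) = f * g by []; rewrite diffM; [|exact: df|exact: dg].
Qed.

Lemma Ck_inv V n (U : set V) (f : V -> R) :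
  open U -> (forall x, U x -> f x != 0) -> Ck n U f -> Ck n U (fun x => (f x)^-1).
Proof.
move=> oU f0; elim: n f f0 => [|n IH] f f0.
  by move=> /= cf x Ux; apply: cvgV; [exact: f0|exact: cf].
move=> Cf; have := Cf => -[df Cf'].
split=> [x Ux|v]; first by apply: differentiableV; [exact: df|exact: f0].
have If := IH _ f0 (CkW Cf).
have := Ck_mul oU (Ck_cst n U (-1 : R)) (Ck_mul oU (Ck_mul oU If If) (Cf' v)).
apply: Ck_ext => // x Ux.
by rewrite diffV; [|exact: df|exact: f0]; rewrite /= expr2 invfM mulN1r scaleNr.
Qed.

Lemma Ck_scalel V W n (U : set V) (f : V -> R) (w : W) :
  open U -> Ck n U f -> Ck n U (fun x => f x *: w).
Proof.
move=> oU; elim: n f => [|n IH] f.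
  by move=> /= cf x Ux; apply: cvgZr_tmp; exact: cf.
move=> [df Cf]; split=> [x Ux|v]; first by apply: differentiableZl; exact: df.
by apply: Ck_ext (IH _ (Cf v)) => // x Ux; rewrite diffZl //; exact: df.
Qed.
End SmoothFunctions.

Section PairLinear.
Variable R : realType.
Local Notation E := 'M[R]_3.

Lemma pair_is_linear (alpha : E) : linear (pair alpha : E -> R^o).
Proof.
move=> c X Y; rewrite !pairE linearP /= mulmxDr -scalemxAr raddfD /=.
by rewrite mxtraceZ.
Qed.

HB.instance Definition _ (alpha : E) :=
  GRing.isLinear.Build R E R^o *:%R (pair alpha) (pair_is_linear alpha).

Lemma pair_delta (alpha : E) j k : pair alpha (delta_mx j k) = alpha j k.
Proof.
rewrite pairE trmx_delta /mxtrace (bigD1 j) //= big1 => [|l lj].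
  rewrite mxE (bigD1 k) //= big1 => [|m mk]; last by rewrite mxE (negbTE mk) mulr0.
  by rewrite mxE !eqxx mulr1 !addr0.
by rewrite mxE big1 // => m _; rewrite mxE (negbTE lj) andbF mulr0.
Qed.

Lemma pair_continuous (alpha : E) : continuous (pair alpha : E -> R).
Proof. exact: (@linear_mx_continuous _ R^o _ _ (pair alpha)). Qed.

Lemma pair_diff (alpha : E) x :
  differentiable (pair alpha : E -> R) x /\ 'd (pair alpha : E -> R) x = pair alpha :> (E -> R).
Proof.
split; first exact/(@linear_differentiable _ _ R^o (pair alpha))/pair_continuous.
exact/(@diff_lin _ _ R^o (pair alpha))/pair_continuous.
Qed.

Lemma Ck_pair (alpha : E) n (U : set E) : Ck n U (pair alpha : E -> R).
Proof. exact/(@Ck_linear _ _ R^o _ _ (pair alpha))/pair_continuous. Qed.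

Lemma differentialE (H : E -> R) a alpha :
  'd H a = pair alpha :> (E -> R) -> differential H a = alpha.
Proof. by move=> h; apply/matrixP => j k; rewrite mxE h pair_delta. Qed.
End PairLinear.

(** * Hamiltonian trajectories stay in a level set *)

Section Trajectories.
Variable R : realType.
Local Notation E := 'M[R]_3.
Implicit Types (a b P : E) (i j k : 'I_3) (r s t : R).

Lemma Phi_mul a b : Phi (a *m b) = Phi a * Phi b.
Proof. by rewrite !Phi_det det_mulmx. Qed.

Lemma Ck_coord n (U : set E) j k : Ck n U (fun a : E => a j k).
Proof.
rewrite (_ : (fun a => _) = pair (delta_mx j k)); first exact: Ck_pair.
by apply/funext => a; rewrite pairE -mxtrace_tr trmx_mul trmxK -pairE pair_delta.
Qed.

Lemma Ck_Phi n : Ck n setT (@Phi R).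
Proof.
have oT : open [set: E] by exact: openT.
have cN (f : E -> R) : Ck n setT f -> Ck n setT (fun x => - f x).
  move=> cf; apply: (Ck_ext oT) (Ck_mul oT (Ck_cst n setT (-1 : R)) cf) => x _.
  exact: mulN1r.
rewrite (funext (@Phi_expand R)).
by repeat (apply: (Ck_add oT) || apply: (Ck_mul oT) || apply: cN); exact: Ck_coord.
Qed.

Lemma Phi_continuous : continuous (@Phi R).
Proof. by move=> x; have /= := Ck_Phi 0; exact. Qed.

Lemma open_star : open (@su2_star R).
Proof.
apply: (@open_comp E R (@Phi R) [set x : R | x != 0]); last exact: open_neq.
by move=> x _; exact: Phi_continuous.
Qed.

Lemma constant_of_derive0 (f : R -> R) s t : s <= t ->
  (forall r, s <= r <= t -> is_derive r (1 : R) f 0) -> f t = f s.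
Proof.
move=> st df.
have [||r _] := @MVT_segment R f (cst 0) s t st.
- by move=> r; rewrite in_itv /= => /andP[/ltW sr /ltW rt]; apply: df; rewrite sr.
- apply: derivable_within_continuous => r; rewrite in_itv /= => /df.
  by move=> h; exact: ex_derive.
- by rewrite mul0r => /eqP; rewrite subr_eq0 => /eqP.
Qed.

Lemma trmx_qmx c v : (qmx c v : E)^T = qmx c (- v).
Proof. by mx3; ring. Qed.

(** The leaf through a will be the set of all b with [same_level a b]. *)
Definition same_level a b := (exists t, b *m b^T = a *m a^T + t%:M) /\ 0 < Phi a * Phi b.

Lemma same_level_refl a : su2_star a -> same_level a a.
Proof.
move=> a0; split; first by exists 0; rewrite raddf0 addr0.
by rewrite -expr2 exprn_even_gt0.
Qed.

Lemma same_level_trans b a c : same_level a b -> same_level b c -> same_level a c.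
Proof.
move=> [[t ab] pab] [[t' bc] pbc]; split.
  by exists (t + t'); rewrite bc ab raddfD addrA.
have b0 : Phi b != 0 by apply: contraTneq pab => ->; rewrite mulr0 ltxx.
rewrite -(@pmulr_rgt0 _ (Phi b ^+ 2)) ?exprn_even_gt0 //.
have -> : Phi b ^+ 2 * (Phi a * Phi c) = Phi a * Phi b * (Phi b * Phi c) by ring.
exact: mulr_gt0.
Qed.

(** Along a trajectory c, the derivative of c c^T is X c^T + (X c^T)^T with
    X c^T = q + Omega, hence equals 2 q.  The sign of Phi cannot change because
    Phi does not vanish on the domain of the Hamiltonian. *)
Lemma ham_step_level i a b :
  ham_step (poisson i) (@su2_star R) a b -> same_level a b.
Proof.
move=> [U [H [c [s [t [[US smH st <- <-] hc]]]]]].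
have c0 r : s <= r <= t -> Phi (c r) != 0 by move=> /hc[/US].
have dc r j k : s <= r <= t -> is_derive r (1 : R) (fun x => c x j k)
    (sharp (poisson i) (c r) (differential H (c r)) j k).
  by move=> /hc[_ /is_derive_mxP].
have sst : s <= s <= t by rewrite lexx.
have stt : s <= t <= t by rewrite lexx andbT.
have dG r : s <= r <= t -> exists q, forall j k,
    is_derive r (1 : R) (fun x => (c x *m (c x)^T) j k) ((q + q)%:M j k : R).
  move=> sr; move: (fun j k => dc r j k sr); set X := sharp _ _ _ => {}dc.
  have [q [v eX]] : exists q v, X *m (c r)^T = qmx q v.
    by do 2 eexists; exact: (sharp_mul_tr i (c0 r sr) (erefl _)).
  exists q => j k.
  have -> : (q + q)%:M = X *m (c r)^T + c r *m X^T.
    rewrite -[c r *m X^T]trmxK trmx_mul trmxK eX trmx_qmx.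
    by rewrite /qmx; move: v {eX} => v; mx3; ring.
  have dC m := dc j m; have dC' m := dc k m.
  under eq_fun do rewrite mxE sum3 !mxE.
  clearbody X; apply: is_derive_eq; rewrite !mxE !sum3 !mxE /GRing.scale /=; ring.
pose N r := c r *m (c r)^T.
split.
  exists (N t 0 0 - N s 0 0); apply/matrixP => j k; rewrite !mxE.
  (* the functions <a_j, a_k> and <a_j, a_j> - <a_1, a_1> are Casimirs *)
  pose f r := N r j k - (j == k)%:R * N r 0 0.
  have : f t = f s.
    apply: constant_of_derive0 => // r sr; have [q dq] := dG r sr.
    have d1 := dq j k; have d2 := dq 0 0.
    rewrite /f /N; apply: is_derive_eq; rewrite /GRing.scale /= !mxE.
    by case: (j == k); rewrite ?mulr1n ?mulr0n; ring.
  by rewrite /f /N !mxE; case: (j == k); rewrite ?mulr1n ?mulr0n; lra.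
rewrite ltNge; apply/negP => sg.
have [||r] := @IVT R (fun r => Phi (c r)) s t 0 st.
- apply: derivable_within_continuous => r; rewrite in_itv /= => sr.
  have dPhi := (Ck_Phi 1).1 (c r) I.
  have [_ dcr] := hc r sr; have /derivable1_diffP dcr' : derivable c r 1 by exact: ex_derive.
  exact/derivable1_diffP/(differentiable_comp dcr' dPhi).
- have := c0 s sst; have := c0 t stt.
  rewrite /Num.min /Num.max; case: (ltP (Phi (c s))) => h; nra.
- by rewrite in_itv /= => /c0 /eqP.
Qed.
End Trajectories.

(** * Linear Hamiltonians generate the rotations *)

Section Rotations.
Variable R : realType.
Local Notation E := 'M[R]_3.
Implicit Types (a b P : E) (i j k : 'I_3) (c s t : R) (u v xi : 'rV[R]_3).
Local Notation axis := (@axis R).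

(** Rodrigues' formula for the rotation about the k-th axis by the angle with
    cosine c and sine s. *)
Definition axis_rot k c s : E :=
  1%:M - s *: skew (axis k) + (1 - c) *: (skew (axis k) *m skew (axis k)).

Lemma skew_axis3 k :
  skew (axis k) *m skew (axis k) *m skew (axis k) = - skew (axis k).
Proof. by mx3; rewrite ?(mxE, sum3) /=; ring. Qed.

(** Up to the sign, the derivative of the rotation with respect to the angle. *)
Lemma axis_rot_skew k c s :
  axis_rot k c s *m skew (axis k) = c *: skew (axis k) - s *: (skew (axis k) *m skew (axis k)).
Proof.
rewrite !mulmxDl mul1mx mulNmx -!scalemxAl skew_axis3.
by apply/matrixP => i j; rewrite !mxE; ring.
Qed.

Lemma Phi_axis_rot k c s : c ^+ 2 + s ^+ 2 = 1 -> Phi (axis_rot k c s) = 1.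
Proof.
by move=> <-; rewrite Phi_expand /axis_rot !(mxE, sum3) /=; cases3;
  rewrite ?(mxE, sum3) /= ?mulr0n ?mulr1n; ring.
Qed.

(** The linear Hamiltonian l^i_xi generates, for pi_i, the simultaneous rotation of
    the rows of a about xi: in [sharp_mul_tr] the matrix b has the single nonzero
    row xi (cof a)^T. *)
Lemma sharp_axis i a xi : Phi a != 0 ->
  sharp (poisson i) a (\matrix_(j, k) ((j == i)%:R * xi 0 k)) = - (a *m skew xi).
Proof.
move=> a0; apply: (mul_tr_inj a0); set u := xi *m (cof a)^T.
have -> : - (a *m skew xi) *m a^T = - skew u.
  rewrite mulNmx -{1}[a]trmxK skew_conj; congr (- skew (_ *m _)).
  exact: cof_tr.
rewrite (@sharp_mul_tr _ _ _ _ (\matrix_(j, k) ((j == i)%:R * u 0 k))) //.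
  clearbody u; rewrite /mxtrace; mx3; rewrite ?(mxE, bracketE, ord3E) /=; ring.
by apply/matrixP => j k; rewrite !mxE mulr_sumr; apply: eq_bigr => l _; rewrite !mxE mulrA.
Qed.

Lemma cos_sin_exists c s : c ^+ 2 + s ^+ 2 = 1 -> 0 <= s ->
  exists2 t, 0 <= t & cos t = c /\ sin t = s.
Proof.
move=> cs s0; have c1 : -1 <= c <= 1 by apply/andP; split; nra.
exists (acos c); first exact: acos_ge0.
split; first by rewrite acosK // in_itv.
rewrite sin_acos // -cs [c ^+ 2 + _]addrC addrK sqrtr_sqr ger0_norm //.
Qed.

(** Trajectories run forward in time, so the orientation of the axis is reversed
    (by the sign e) when the sine is negative. *)
Lemma ham_step_axis_rot i k a c s : su2_star a -> c ^+ 2 + s ^+ 2 = 1 ->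
  ham_step (poisson i) (@su2_star R) a (a *m axis_rot k c s).
Proof.
move=> a0 cs.
(* acos only yields angles with a nonnegative sine *)
have [e [e2 es]] : exists e : R, e ^+ 2 = 1 /\ 0 <= e * s.
  by have [s0|/ltW s0] := lerP 0 s; [exists 1|exists (-1)];
    rewrite ?sqrrN expr1n ?mul1r ?mulN1r ?oppr_ge0.
have [t t0 [ct st]] : exists2 t, 0 <= t & cos t = c /\ sin t = e * s.
  by apply: cos_sin_exists; rewrite // exprMn e2 mul1r.
pose al : E := \matrix_(j, l) ((j == i)%:R * (e *: axis k) 0 l).
exists (@su2_star R), (pair al), (fun t => a *m axis_rot k (cos t) (e * sin t)), 0, t.
split; first split => //.
- by split; [exact: open_star|move=> n; exact: Ck_pair].
- rewrite cos0 sin0 mulr0 /axis_rot subrr scale0r scale0r subr0 addr0 mulmx1 //.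
- by rewrite ct st mulrA -expr2 e2 mul1r.
move=> r _.
have r0 : Phi (a *m axis_rot k (cos r) (e * sin r)) != 0.
  by rewrite Phi_mul Phi_axis_rot ?mulr1 // exprMn e2 mul1r cos2Dsin2.
split; first exact: r0.
rewrite (differentialE (pair_diff al _).2) sharp_axis //.
have -> : skew (e *: axis k) = e *: skew (axis k) by mx3; ring.
rewrite -scalemxAr -mulmxA axis_rot_skew /axis_rot.
move: (skew (axis k)) => K.
set K2 := K *m K; clearbody K2.
apply/is_derive_mxP => j l; under eq_fun do rewrite !mulmxDr mulmx1 mulmxN -!scalemxAr !mxE.
apply: is_derive_eq; rewrite !(mulmxDr, mulmxN) -!scalemxAr !mxE /GRing.scale /=.
rewrite !mulr0 ?add0r.
ring: e2.
Qed.
End Rotations.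

Section RotationGroup.
Variable R : realType.
Local Notation E := 'M[R]_3.
Implicit Types (a b P Q : E) (i j k : 'I_3) (c s t : R).

Definition rotation Q : Prop := Q^T *m Q = 1%:M /\ \det Q = 1.

Lemma rotation_mul P Q : rotation P -> rotation Q -> rotation (P *m Q).
Proof.
move=> [PP dP] [QQ dQ]; split; last by rewrite det_mulmx dP dQ mulr1.
by rewrite trmx_mul mulmxA -(mulmxA Q^T) PP mulmx1.
Qed.

Lemma rotation_tr Q : rotation Q -> rotation Q^T.
Proof. by move=> [QQ dQ]; split; [rewrite trmxK; exact: mulmx1C|rewrite det_tr]. Qed.

Lemma rotation_axis_rot k c s : c ^+ 2 + s ^+ 2 = 1 -> rotation (axis_rot k c s).
Proof.
move=> cs; split; last by rewrite -Phi_det Phi_axis_rot.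
have s2 : s ^+ 2 = 1 - c ^+ 2 by rewrite -cs addrC addKr.
by rewrite /axis_rot; mx3; rewrite ?(mxE, sum3) /= ?mulr0n ?mulr1n; ring: s2.
Qed.

Lemma givens (x y : R) : exists c s, [/\ c ^+ 2 + s ^+ 2 = 1, 0 <= c * x + s * y
  & c * y - s * x = 0].
Proof.
have [n0|n0] := eqVneq (x ^+ 2 + y ^+ 2) 0.
  move: n0 => /eqP; rewrite paddr_eq0 ?sqr_ge0 // !sqrf_eq0 => /andP[/eqP-> /eqP->].
  by exists 1, 0; split; rewrite ?mulr0 ?addr0 ?subrr ?expr1n ?expr0n ?addr0.
have n_gt0 : 0 < x ^+ 2 + y ^+ 2 by rewrite lt_def n0 addr_ge0 ?sqr_ge0.
pose n := Num.sqrt (x ^+ 2 + y ^+ 2).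
have nn : n ^+ 2 = x ^+ 2 + y ^+ 2 by rewrite sqr_sqrtr ?ltW.
have n1 : 0 < n by rewrite sqrtr_gt0.
have n2 : n != 0 by rewrite gt_eqF.
exists (x / n), (y / n); split.
- by rewrite !expr_div_n -mulrDl -nn divff // expf_neq0.
- have -> : x / n * x + y / n * y = n.
    by apply: (mulIf n2); rewrite -[RHS]expr2 nn; field.
  exact: ltW.
- by field.
Qed.

(** Two plane rotations bring the first row of Q to (1, 0, 0); what remains is a
    rotation about the first axis. *)
Lemma euler_angles Q : rotation Q -> exists c0 s0 c1 s1 c2 s2,
  [/\ c0 ^+ 2 + s0 ^+ 2 = 1, c1 ^+ 2 + s1 ^+ 2 = 1, c2 ^+ 2 + s2 ^+ 2 = 1 &
   Q *m axis_rot 0 c0 s0 *m axis_rot 2%:R c1 s1 *m axis_rot 0 c2 s2 = 1%:M].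
Proof.
move=> rQ.
have rot0 A c s : [/\ forall j, (A *m axis_rot 0 c s) j 0 = A j 0,
    forall j, (A *m axis_rot 0 c s) j 1 = c * A j 1 + s * A j 2%:R &
    forall j, (A *m axis_rot 0 c s) j 2%:R = c * A j 2%:R - s * A j 1].
  by rewrite /axis_rot; split=> j; rewrite !(mxE, sum3) /= ?ord3E /= ?mulr0n ?mulr1n; ring.
have rot2 A c s : [/\ forall j, (A *m axis_rot 2%:R c s) j 0 = c * A j 0 + s * A j 1,
    forall j, (A *m axis_rot 2%:R c s) j 1 = c * A j 1 - s * A j 0 &
    forall j, (A *m axis_rot 2%:R c s) j 2%:R = A j 2%:R].
  by rewrite /axis_rot; split=> j; rewrite !(mxE, sum3) /= ?ord3E /= ?mulr0n ?mulr1n; ring.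
have [c0 [s0 [cs0 _ z0]]] := givens (Q 0 1) (Q 0 2%:R).
pose Q1 := Q *m axis_rot 0 c0 s0.
have [c1 [s1 [cs1 p1 z1]]] := givens (Q1 0 0) (Q1 0 1).
have [Q2 Q2E] : exists Q2, Q2 = Q1 *m axis_rot 2%:R c1 s1 by eexists.
have rQ2 : rotation Q2.
  by rewrite Q2E; apply: rotation_mul (rotation_axis_rot _ cs1);
    exact: rotation_mul (rotation_axis_rot _ cs0).
have q02 : Q2 0 2%:R = 0
  by rewrite Q2E; have [_ _ ->] := rot2 Q1 c1 s1; have [_ _ ->] := rot0 Q c0 s0.
have q01 : Q2 0 1 = 0 by rewrite Q2E; have [_ -> _] := rot2 Q1 c1 s1.
have q00p : 0 <= Q2 0 0 by rewrite Q2E; have [-> _ _] := rot2 Q1 c1 s1.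
(* equality with the cofactor matrix gives the shape of the remaining block *)
have [QQ dQ] := rQ2; have cofQ := cof_rotation QQ dQ.
have q00 : Q2 0 0 = 1.
  have /matrixP/(_ 0 0) := mulmx1C QQ; rewrite !(mxE, sum3) /= q01 q02 mulr1n; nra.
have /matrixP Qe := QQ.
have [q10 q20] : Q2 1 0 = 0 /\ Q2 2%:R 0 = 0.
  by have := Qe 0 0; rewrite !(mxE, sum3) /= q00 mulr1n; split; nra.
have q22 : Q2 2%:R 2%:R = Q2 1 1.
  by rewrite -[in RHS]cofQ mxE ?ord3E q00 q02; ring.
have q12 : Q2 1 2%:R = - Q2 2%:R 1.
  by rewrite -[in LHS]cofQ mxE ?ord3E q00 q01; ring.
have q1 : Q2 1 1 ^+ 2 + Q2 2%:R 1 ^+ 2 = 1.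
  by have := Qe 1 1; rewrite !(mxE, sum3) /= q01 mulr1n; lra.
have q21 : Q2 2%:R 1 ^+ 2 = 1 - Q2 1 1 ^+ 2 by rewrite -q1 addrC addKr.
exists c0, s0, c1, s1, (Q2 1 1), (- Q2 2%:R 1); split=> //.
  by rewrite sqrrN.
rewrite -/Q1 -Q2E.
have [e0 e1 e2] := rot0 Q2 (Q2 1 1) (- Q2 2%:R 1).
apply/matrixP => j k; case: (ord3P k) => -> {k}; rewrite ?e0 ?e1 ?e2;
  case: (ord3P j) => -> {j}; rewrite !mxE /= ?q00 ?q01 ?q02 ?q10 ?q20 ?q22 ?q12 ?mulr1n ?mulr0n;
  ring: q21.
Qed.

Definition reach i := clos_refl_trans E (ham_step (poisson i) (@su2_star R)).

Lemma reach_rotation i a Q : su2_star a -> rotation Q -> reach i a (a *m Q).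
Proof.
move=> a0 rQ.
have [c0 [s0 [c1 [s1 [c2 [s2 [h0 h1 h2 e]]]]]]] := euler_angles (rotation_tr rQ).
have aQ0 : su2_star (a *m Q).
  by case: rQ => _ dQ; rewrite /su2_star /= Phi_mul (Phi_det Q) dQ mulr1.
have st k c s b : su2_star b -> c ^+ 2 + s ^+ 2 = 1 -> su2_star (b *m axis_rot k c s).
  by move=> b0 cs; rewrite /su2_star /= Phi_mul Phi_axis_rot // mulr1.
have -> : a *m Q = a *m axis_rot 0 c0 s0 *m axis_rot 2%:R c1 s1 *m axis_rot 0 c2 s2.
  by rewrite -[LHS]mulmx1 -e !mulmxA -(mulmxA a) (mulmx1C rQ.1) mulmx1.
apply: rt_trans; last first.
  apply: rt_step; apply: ham_step_axis_rot h2; exact: (st _ _ _ _ (st _ _ _ _ a0 h0) h1).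
apply: rt_trans; last by apply: rt_step; apply: ham_step_axis_rot h1; exact: st h0.
by apply: rt_step; exact: ham_step_axis_rot.
Qed.
End RotationGroup.

(** * A Hamiltonian that dilates the Gram matrix *)

Section Dilation.
Variable R : realType.
Local Notation E := 'M[R]_3.
Implicit Types (a b P Q : E) (i j k : 'I_3) (e s t : R) (d : 'rV[R]_3).
Local Notation axis := (@axis R).

(** A curve of points whose Gram matrices P (D + t) P^T differ by scalars; the
    sign e of Phi is a parameter. *)
Definition dilation P d e t : E := e *: (P *m diag_mx (\row_k Num.sqrt (d 0 k + t))).

Lemma dilation_gram P d e t : e ^+ 2 = 1 -> rotation P -> (forall k, 0 <= d 0 k + t) ->
  dilation P d e t *m (dilation P d e t)^T = P *m diag_mx d *m P^T + t%:M.
Proof.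
move=> e2 rP dt; rewrite /dilation linearZ /= -scalemxAl -scalemxAr scalerA -expr2 e2 scale1r.
rewrite trmx_mul tr_diag_mx !mulmxA -(mulmxA P (diag_mx _)) mulmx_diag.
rewrite (_ : \row_j _ = d + const_mx t); last first.
  by apply/rowP => k; rewrite !mxE -expr2 sqr_sqrtr.
rewrite raddfD /= mulmxDr mulmxDl; congr (_ + _).
by rewrite diag_const_mx mul_mx_scalar -scalemxAl (mulmx1C rP.1) scalemx1.
Qed.

Lemma dilation_sign P d e t : e ^+ 2 = 1 -> rotation P -> (forall k, 0 < d 0 k + t) ->
  0 < e * Phi (dilation P d e t).
Proof.
move=> e2 rP dt; rewrite /dilation -mul_scalar_mx !Phi_mul !Phi_det rP.2 mul1r det_scalar det_diag.
rewrite mulrA -exprS (exprM e 2 2) e2 expr1n mul1r.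
by apply: prodr_gt0 => k _; rewrite mxE sqrtr_gt0.
Qed.

Lemma pair_coord P a j k : pair (P *m delta_mx j k) a = (P^T *m a) j k.
Proof.
by rewrite -pair_delta !pairE -[RHS]mxtrace_tr !trmx_mul !trmxK mulmxA [RHS]mxtrace_mulC mulmxA.
Qed.

Lemma pair_comb (A B C X : E) (x y z : R) :
  pair (x *: A + y *: B + z *: C) X = pair A X * x + pair B X * y + pair C X * z.
Proof.
by rewrite !pairE !mulmxDl !mxtraceD -!scalemxAl !mxtraceZ ![_ * \tr _]mulrC.
Qed.

(** At a zero of f only the differential of f contributes. *)
Lemma diff_mul_zero (V : normedModType R) (f g : V -> R) x :
  differentiable f x -> differentiable g x -> f x = 0 ->
  'd (fun y => f y * g y) x = (fun v => 'd f x v * g x) :> (V -> R).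
Proof.
move=> df dg f0; have -> : (fun y => f y * g y) = f * g by [].
rewrite diffM //; apply/funext => v; rewrite f0.
by rewrite -[LHS]/(0 * 'd g x v + g x * 'd f x v) mul0r add0r mulrC.
Qed.

(** The velocity of the curve has the quaternion (1/2, 0), so by [sharp_mul_tr]
    the differential alpha of the Hamiltonian must satisfy
    vpart (alpha (cof a)^T) = axis i / 2 and have no trace, up to covectors
    vanishing on the leaf.  In the coordinates m = P^T a, where the curve is
    diagonal, the axis becomes the row i of P, and this is achieved by
      H = sum_k (P_ik / 2) m_(k+1,k+2) / (m_(k,k) m_(k+1,k+1)),
    whose numerators vanish along the curve.  The factor eta, the total change
    of t, lets the time run over [0, 1] in either direction of t. *)
Lemma ham_step_dilation i P d e t0 t1 : e ^+ 2 = 1 -> rotation P ->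
  (forall k, 0 < d 0 k + t0) -> (forall k, 0 < d 0 k + t1) ->
  ham_step (poisson i) (@su2_star R) (dilation P d e t0) (dilation P d e t1).
Proof.
move=> e2 rP dt0 dt1.
have e0 : e != 0 by apply: contra_eq_neq e2 => ->; rewrite expr0n eq_sym oner_eq0.
pose eta := t1 - t0; pose tau r := t0 + r * eta.
have dtau r k : 0 <= r <= 1 -> 0 < d 0 k + tau r.
  move=> /andP[r0 r1]; have A := dt0 k; have B := dt1 k; rewrite /tau /eta.
  have [t01|/ltW t10] := lerP t0 t1.
    by apply: lt_le_trans A _; rewrite lerD2l lerDl mulr_ge0 // subr_ge0.
  have -> : d 0 k + (t0 + r * (t1 - t0)) = d 0 k + t1 + (1 - r) * (t0 - t1) by ring.
  by apply: lt_le_trans B _; rewrite lerDl mulr_ge0 // subr_ge0.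
pose w k := eta / 2 * P i k.
pose m j k := pair (P *m delta_mx j k).
pose g k a := w k * ((m k k a)^-1 * (m (k + 1) (k + 1) a)^-1).
pose T k a := m (k + 1) (k + 2%:R) a * g k a.
pose U := [set a : E | Phi a * (m 0 0 a * (m 1 1 a * m 2%:R 2%:R a)) != 0].
have UE a : U a -> Phi a != 0 /\ forall k, m k k a != 0.
  rewrite /U /= !mulf_eq0 !negb_or => /and4P[? ? ? ?]; split=> // k.
  by case: (ord3P k) => ->.
have oT : open [set: E] by exact: openT.
have oU : open U.
  apply: (@open_comp E R (fun a => Phi a * (m 0 0 a * (m 1 1 a * m 2%:R 2%:R a)))
     [set x : R | x != 0]); last exact: open_neq.
  move=> x _; have : Ck 0 setT (fun a => Phi a * (m 0 0 a * (m 1 1 a * m 2%:R 2%:R a))).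
    apply: (Ck_mul oT); first exact: Ck_Phi.
    by do 2 (apply: (Ck_mul oT); first exact: Ck_pair); exact: Ck_pair.
  exact.
have Cg n k : Ck n U (g k).
  apply: (Ck_mul oU); first exact: Ck_cst.
  by apply: (Ck_mul oU); apply: (Ck_inv oU) => [a /UE[_ //]|]; exact: Ck_pair.
have CT n k : Ck n U (T k) by apply: (Ck_mul oU) => //; exact: Ck_pair.
pose c r := dilation P d e (tau r).
pose s r k := Num.sqrt (d 0 k + tau r).
have mc r j k : m j k (c r) = (j == k)%:R * (e * s r k).
  rewrite /m pair_coord /c /dilation -scalemxAr mulmxA rP.1 mul1mx !mxE.
  by case: eqVneq => [->|_]; rewrite ?mulr1n ?mulr0n ?mul1r ?mul0r ?mulr0.
have s0 r k : 0 <= r <= 1 -> s r k != 0 by move=> /(dtau r k) ?; rewrite gt_eqF // sqrtr_gt0.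
have Uc r : 0 <= r <= 1 -> U (c r).
  move=> r01; rewrite /U /= !mc !eqxx !mul1r !mulf_neq0 ?s0 //.
  have := dilation_sign e2 rP (fun k => dtau r k r01).
  by apply: contraTneq => ->; rewrite mulr0 ltxx.
exists U, (fun a => T 0 a + T 1 a + T 2%:R a), c, 0, 1; split; first split.
- by move=> a /UE[].
- by split=> // n; do 2 (apply: (Ck_add oU) => //).
- exact: ler01.
- by rewrite /c /tau mul0r addr0.
- by rewrite /c /tau mul1r /eta addrC subrK.
move=> r r01; split; first exact: Uc.
have [Phi0 _] := UE _ (Uc r r01).
pose al := \sum_k g k (c r) *: (P *m delta_mx (k + 1) (k + 2%:R)).
have -> : differential (fun a => T 0 a + T 1 a + T 2%:R a) (c r) = al.
  apply: differentialE.
  have dT k : differentiable (T k) (c r) by exact: (CT 1%N k).1 (Uc r r01).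
  have -> : (fun a => T 0 a + T 1 a + T 2%:R a) = T 0 + T 1 + T 2%:R by [].
  rewrite diffD; [|exact: differentiableD|by []]; rewrite diffD //.
  have dTE k : 'd (T k) (c r) = (fun v => m (k + 1) (k + 2%:R) v * g k (c r)) :> (E -> R).
    rewrite /T diff_mul_zero; [by rewrite (pair_diff _ _).2|exact: (pair_diff _ _).1
      |exact: (Cg 1%N k).1 (Uc r r01)|].
    by rewrite mc; case: (ord3P k) => ->; rewrite ?ord3E mul0r.
  apply/funext => v.
  rewrite /al sum3 pair_comb.
  rewrite -[LHS]/('d (T 0) (c r) v + 'd (T 1) (c r) v + 'd (T 2%:R) (c r) v).
  have dTv k := congr1 (fun F => F v) (dTE k).
  exact: (congr2 +%R (congr2 +%R (dTv 0) (dTv 1)) (dTv 2%:R)).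
have cofc : cof (c r) = P *m diag_mx (\row_k (s r (k + 1) * s r (k + 2%:R))).
  rewrite /c /dilation -mul_scalar_mx !cof_mul (cof_rotation rP.1 rP.2).
  have -> : cof e%:M = 1%:M by mx3; ring: e2.
  rewrite mul1mx; congr (_ *m _); mx3; rewrite /s; ring.
pose b' : E := \matrix_(j, k) ((k == j + 1)%:R * w (j + 2%:R)).
have alE : al *m (cof (c r))^T = P *m b' *m P^T.
  rewrite cofc trmx_mul tr_diag_mx mulmxA; congr (_ *m _).
  rewrite /al; under eq_bigr do rewrite scalemxAr; rewrite -mulmx_sumr -mulmxA; congr (_ *m _).
  have gE k : g k (c r) = w k / (s r k * s r (k + 1)).
    rewrite /g !mc !eqxx !mul1r -invfM; congr (_ / _).
    by rewrite mulrACA -expr2 e2 mul1r.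
  rewrite sum3 !gE; have := s0 r ^~ r01; rewrite -/(s r).
  move: (s r) => sr sr0; have [S0 S1 S2] := And3 (sr0 0) (sr0 1) (sr0 2%:R).
  by mx3; rewrite ?(mxE, ord3E) /=; field; rewrite ?S0 ?S1 ?S2.
have vb : vpart (al *m (cof (c r))^T) = (eta / 2) *: axis i.
  rewrite alE -{1}[P]trmxK vpart_conj cof_tr (cof_rotation rP.1 rP.2).
  have -> : vpart b' = (eta / 2) *: row i P.
    by apply/rowP => k; rewrite /b' /w !mxE; cases3; ring.
  rewrite -scalemxAl -row_mul (mulmx1C rP.1); congr (_ *: _).
  by apply/rowP => k; rewrite !mxE eq_sym.
have tb : \tr (al *m (cof (c r))^T) = 0.
  rewrite alE mxtrace_mulC mulmxA rP.1 mul1mx /mxtrace sum3 !mxE /=; ring.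
have -> : sharp (poisson i) (c r) al =
    e *: (P *m diag_mx (\row_k (eta / (2 * s r k)))).
  apply: (mul_tr_inj Phi0); rewrite (sharp_mul_tr i Phi0 (erefl _)) vb tb scale0r subr0.
  have -> : bracket (axis i) ((eta / 2) *: axis i) = 0.
    by apply/rowP => k; rewrite !(bracketE, mxE); ring.
  rewrite /c /dilation linearZ /= -scalemxAl -scalemxAr scalerA -expr2 e2 scale1r.
  rewrite trmx_mul tr_diag_mx !mulmxA -(mulmxA P (diag_mx _)) mulmx_diag.
  rewrite (_ : \row_j _ = const_mx (eta / 2)); last first.
    by apply/rowP => k; rewrite !mxE -/(s r k); have := s0 r k r01 => ?; field.
  rewrite diag_const_mx mul_mx_scalar -scalemxAl (mulmx1C rP.1) scalemx1.
  by rewrite !mxE !eqxx mulr1; mx3; ring.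
apply/is_derive_mxP => j k; rewrite /c /dilation.
have rayE (v : 'rV[R]_3) : (e *: (P *m diag_mx v)) j k = e * (P j k * v 0 k).
  by rewrite mxE mul_mx_diag mxE.
under eq_fun do rewrite rayE mxE.
rewrite rayE mxE.
have dd : is_derive r (1 : R) (fun x => d 0 k + tau x) eta.
  by rewrite /tau; apply: is_derive_eq; rewrite /GRing.scale /=; ring.
have ds := @is_derive1_sqrt R (d 0 k + tau r) (dtau r k r01).
have dc := @is_derive1_comp R Num.sqrt (fun x => d 0 k + tau x) r _ _ ds dd.
have -> : e * (P j k * (eta / (2 * s r k))) = e * P j k * ((2 * s r k)^-1 * eta) by ring.
have -> : (fun x => e * (P j k * Num.sqrt (d 0 k + tau x))) =
   (e * P j k) *: (Num.sqrt \o (fun x => d 0 k + tau x)).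
  by apply/funext => x; rewrite /= !fctE /GRing.scale /= mulrA.
exact: is_deriveZ.
Qed.
End Dilation.

(** * The leaves are the level sets *)

Section LeafLevel.
Variable R : realType.
Local Notation E := 'M[R]_3.
Implicit Types (a b x y P Q : E) (i j k : 'I_3) (e s t : R) (d : 'rV[R]_3).

(** Q = a^-1 b is orthogonal, and the sign condition makes its determinant 1. *)
Lemma polar a b : a *m a^T = b *m b^T -> 0 < Phi a * Phi b ->
  exists2 Q, rotation Q & b = a *m Q.
Proof.
move=> ab pab; have a0 : Phi a != 0 by apply: contraTneq pab => ->; rewrite mul0r ltxx.
pose B := (Phi a)^-1 *: (cof a)^T; have aB : a *m B = 1%:M.
  rewrite -scalemxAr -[a *m _]trmxK trmx_mul trmxK mul_cof_tr tr_scalar_mx.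
  by rewrite scale_scalar_mx mulVf.
have Ba : B *m a = 1%:M by exact: mulmx1C.
have bE : b = a *m (B *m b) by rewrite mulmxA aB mul1mx.
have QQ : (B *m b) *m (B *m b)^T = 1%:M.
  rewrite trmx_mul mulmxA -(mulmxA B) -ab !mulmxA Ba mul1mx -trmx_mul Ba.
  exact: trmx1.
exists (B *m b) => //; split; first exact: mulmx1C.
have := congr1 determinant QQ; rewrite det_mulmx det_tr det1 -expr2 => /eqP.
rewrite sqrf_eq1 => /orP[/eqP//|/eqP dQ].
by move: pab; rewrite [in Phi b]bE Phi_mul (Phi_det (B *m b)) dQ; nra.
Qed.

(** The numbers d_k + t are the squared lengths of the rows of P^T x, none of
    which is zero. *)
Lemma gram_pos P d t x : rotation P -> Phi x != 0 ->
  x *m x^T = P *m diag_mx d *m P^T + t%:M -> forall k, 0 < d 0 k + t.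
Proof.
move=> rP x0 gx k; pose w := P^T *m x.
have w0 : Phi w != 0 by rewrite Phi_mul (Phi_det P^T) det_tr rP.2 mul1r.
have : w *m w^T = diag_mx d + t%:M.
  rewrite trmx_mul trmxK mulmxA -(mulmxA P^T) gx mulmxDr mulmxDl !mulmxA rP.1 mul1mx.
  by rewrite -mulmxA rP.1 mulmx1 mul_mx_scalar -scalemxAl rP.1 scalemx1.
move=> /matrixP/(_ k k); rewrite mulmx_trE !mxE eqxx mulr1n => <-.
rewrite inner_gt0; apply: contraNneq w0 => /rowP wk.
have {}wk l : w k l = 0 by have := wk l; rewrite !mxE.
by apply/eqP; rewrite Phi_expand; move: k wk => k; case: (ord3P k) => -> wk; rewrite !wk; ring.
Qed.

Lemma reach_polar i a b : a *m a^T = b *m b^T -> 0 < Phi a * Phi b -> reach i a b.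
Proof.
move=> ab pab; have [Q rQ ->] := polar ab pab; apply: reach_rotation => //.
by apply: contraTneq pab => ->; rewrite mul0r ltxx.
Qed.

Lemma reach_same_level i a b : reach i a b -> su2_star a -> same_level a b.
Proof.
elim=> {a b} [a b /ham_step_level//|a|a b c _ IHab _ IHbc a0]; first exact: same_level_refl.
have ab := IHab a0; apply: same_level_trans (ab) (IHbc _).
by case: ab => _; apply: contraTneq => ->; rewrite mulr0 ltxx.
Qed.

(** Rotate the point onto the dilation curve, follow the curve, rotate back. *)
Lemma same_level_reach i a b : same_level a b -> reach i a b.
Proof.
move=> [[t gb] pab].
have [P [d [PP dP gP _ _]]] : exists (P : E) d, [/\ P^T *m P = 1%:M, \det P = 1,
     a *m a^T = P *m diag_mx d *m P^T, d 0 1 <= d 0 0 & d 0 2%:R <= d 0 1].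
  by apply: symmetric_diagonalizable; rewrite trmx_mul trmxK.
have rP : rotation P by [].
have a0 : Phi a != 0 by apply: contraTneq pab => ->; rewrite mul0r ltxx.
have b0 : Phi b != 0 by apply: contraTneq pab => ->; rewrite mulr0 ltxx.
have da : forall k, 0 < d 0 k + 0.
  by apply: gram_pos rP a0 _; rewrite gP raddf0 addr0.
have db : forall k, 0 < d 0 k + t by apply: gram_pos rP b0 _; rewrite gb gP.
have [e [e2 ea eb]] : exists e, [/\ e ^+ 2 = 1, 0 < e * Phi a & 0 < e * Phi b].
  by have [a1|a1|/eqP] := ltgtP (Phi a) 0; rewrite ?(negbTE a0) //;
    [exists (-1)|exists 1]; split; rewrite ?sqrrN ?expr1n //; nra.
have ra := dilation_sign e2 rP da; have rb := dilation_sign e2 rP db.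
apply: (@rt_trans _ _ _ (dilation P d e 0)); last apply: (@rt_trans _ _ _ (dilation P d e t)).
- apply: reach_polar; last nra.
  by rewrite dilation_gram // ?gP ?raddf0 ?addr0 // => k; rewrite ltW // da.
- exact/rt_step/ham_step_dilation.
- apply: reach_polar; last nra.
  by rewrite dilation_gram // ?gb ?gP // => k; rewrite ltW // db.
Qed.

Lemma symplectic_leafE i L : symplectic_leaf (poisson i) (@su2_star R) L ->
  exists2 x, su2_star x & L = [set y | same_level x y].
Proof.
move=> [x x0 ->]; exists x => //; apply/seteqP; split=> y /=.
  by move=> /reach_same_level; exact.
exact: same_level_reach.
Qed.

(** Differentiating at 0 the functions that are constant on the level set shows
    that X a^T + (X a^T)^T is scalar. *)
Lemma tangent_level x a X : su2_star x -> tangent [set y | same_level x y] a X ->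
  exists c v, X *m a^T = qmx c v.
Proof.
move=> x0 [I [c [[oI smI] I0 cL c0 dX]]].
have dc : differentiable c 0 by exact: (smI 1%N).1.
have dcX : is_derive (0 : R) (1 : R) c X.
  by apply: DeriveDef; [exact: diff_derivable|rewrite deriveE].
pose M := X *m a^T + (X *m a^T)^T.
have MM j k : M j k - (j == k)%:R * M 0 0 = 0.
  pose f t := (c t *m (c t)^T) j k - (j == k)%:R * (c t *m (c t)^T) 0 0.
  have <- : 'D_1 f 0 = M j k - (j == k)%:R * M 0 0.
    apply: derive_val; have dcE := (is_derive_mxP _ _ _).1 dcX.
    have d1 l := dcE j l; have d2 l := dcE k l; have d3 l := dcE 0 l.
    rewrite /f; under eq_fun do rewrite !mxE !sum3 !mxE.
    apply: is_derive_eq; rewrite c0 /M !mxE !sum3 !mxE /GRing.scale /=; ring.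
  transitivity ('D_1 (cst (f 0) : R -> R) (0 : R)); last exact: derive_cst.
  apply: near_eq_derive.
  have fE t : I t -> f t = (x *m x^T) j k - (j == k)%:R * (x *m x^T) 0 0.
    move=> /cL[[s gs] _]; rewrite /f gs !mxE.
    by case: (j == k); rewrite ?mulr1n ?mulr0n; ring.
  have : nbhs (0 : R) I by exact: open_nbhs_nbhs.
  by apply: filterS => t It; rewrite /= !fE.
exists (M 0 0 / 2), (2^-1 *: vpart (X *m a^T)).
have eX j k : (X *m a^T) k j = (j == k)%:R * M 0 0 - (X *m a^T) j k.
  by have := MM j k; rewrite {1}/M mxE [_^T j k]mxE; lra.
clearbody M; move: (X *m a^T) eX => Y eX.
apply/matrixP => j k; rewrite !mxE.
have e00 := eX 0 0; have e11 := eX 1 1; have e22 := eX 2%:R 2%:R.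
have e01 := eX 0 1; have e02 := eX 0 2%:R; have e12 := eX 1 2%:R.
move: e00 e11 e22 e01 e02 e12; rewrite ?eqxx /=.
by case: (ord3P j) => ->; case: (ord3P k) => ->; rewrite ?ord3E /= ?mulr1n ?mulr0n; lra.
Qed.
End LeafLevel.

(** * Tangent vectors and the comparison map *)

Section LevelGeometry.
Variable R : realType.
Local Notation E := 'M[R]_3.
Implicit Types (a b x y P Q : E) (i j k : 'I_3) (e s t : R) (d : 'rV[R]_3).

Lemma diff_curve (V W : normedModType R) (f g : V -> R) (A B C : W) (t : V) :
  differentiable f t -> differentiable g t ->
  'd (fun r => f r *: A + g r *: B + C) t =
  (fun v => 'd f t v *: A + 'd g t v *: B) :> (V -> W).
Proof.
move=> df dg; have dA := differentiableZl A df; have dB := differentiableZl B dg.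
have -> : (fun r => f r *: A + g r *: B + C) =
  (fun r => f r *: A) + (fun r => g r *: B) + cst C by [].
have dAB := differentiableD dA dB.
rewrite (diffD dAB (differentiable_cst C t)) (diffD dA dB) diff_cst.
rewrite (diffZl A df) (diffZl B dg).
by apply/funext => v; rewrite -[LHS]/('d f t v *: A + 'd g t v *: B + 0) addr0.
Qed.

(** The velocity of a rotation about an axis.  The rational parametrization of
    the circle, with sine t h(t) and cosine 1 - t^2 h(t) for
    h(t) = 2 / (1 + t^2), makes smoothness a matter of algebra. *)
Lemma tangent_exists x a : same_level x a ->
  exists2 X, tangent [set y | same_level x y] a X & X != 0.
Proof.
move=> xa; have a0 : Phi a != 0 by case: xa => _; apply: contraTneq => ->; rewrite mulr0 ltxx.
pose K := skew (axis R 0).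
pose h (t : R) : R := 2 * (1 + t * t)^-1.
have h0 t : 1 + t * t != 0 by rewrite gt_eqF // ltr_wpDr ?ltr01 // -expr2 sqr_ge0.
have oT : open [set: R] by exact: openT.
have Cid n : Ck n setT (fun t : R => t : R).
  by apply: (@Ck_linear R R R^o n setT idfun) => y; exact: cvg_id.
have Ch n : Ck n setT h.
  apply: (Ck_mul oT); first exact: Ck_cst.
  apply: (Ck_inv oT) => [t _|]; first exact: h0.
  by apply: (Ck_add oT); [exact: Ck_cst|exact: Ck_mul].
have Cth n : Ck n setT (fun t : R => t * h t) by exact: Ck_mul.
have Ctth n : Ck n setT (fun t : R => t * (t * h t)) by exact: Ck_mul.
pose c t := (t * h t) *: - (a *m K) + (t * (t * h t)) *: (a *m (K *m K)) + a.
have cE t : c t = a *m axis_rot 0 (1 - t * (t * h t)) (t * h t).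
  rewrite /c /axis_rot -/K opprB addrCA subrr addr0 !mulmxDr mulmx1 mulmxN -!scalemxAr scalerN.
  by rewrite addrC addrA.
have cs t : (1 - t * (t * h t)) ^+ 2 + (t * h t) ^+ 2 = 1.
  by rewrite /h; field; rewrite h0.
have rt t := rotation_axis_rot 0 (cs t).
have Cc n : Ck n setT c.
  apply: (Ck_add oT); last exact: Ck_cst.
  by apply: (Ck_add oT); exact: Ck_scalel.
exists (2 *: - (a *m K)).
  exists setT, c; split => //.
  - move=> t _; apply: (same_level_trans xa); rewrite cE; split.
      exists 0; rewrite raddf0 addr0 trmx_mul mulmxA -(mulmxA a).
      by rewrite (mulmx1C (rt t).1) mulmx1.
    by rewrite Phi_mul Phi_axis_rot // mulr1 -expr2 exprn_even_gt0.
  - by rewrite cE !mul0r subr0 /axis_rot subrr !scale0r subr0 addr0 mulmx1.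
  - have d1 : differentiable (fun t : R => t * h t) 0 by exact: (Cth 1%N).1.
    have d2 : differentiable (fun t : R => t * (t * h t)) 0 by exact: (Ctth 1%N).1.
    have di : differentiable (fun t : R => t) 0 by exact: (Cid 1%N).1.
    have dh : differentiable h 0 by exact: (Ch 1%N).1.
    rewrite (diff_curve _ _ _ d1 d2) (diff_mul_zero di d1) // (diff_mul_zero di dh) //.
    have -> : 'd (fun t : R => t) (0 : R) (1 : R) = (1 : R).
      by have := @diff_lin R R R^o idfun (0 : R) => /= -> // ?; exact.
    by rewrite mul0r mulr0 scale0r !addr0 mul1r /h mul0r addr0 invr1 mulr1.
rewrite scalerN oppr_eq0 scaler_eq0 pnatr_eq0 /=; apply/negP => /eqP aK.
have /(congr1 (mulmx (cof a)^T)) := aK.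
rewrite mulmxA mul_tr_cof mulmx0 mul_scalar_mx => /eqP.
rewrite scaler_eq0 (negbTE a0) /= => /eqP/matrixP/(_ 1 2%:R).
by rewrite !mxE /= => /eqP; rewrite oner_eq0.
Qed.

Lemma metric_sign x a X : su2_star x -> same_level x a ->
  tangent [set y | same_level x y] a X -> X != 0 ->
  exists2 q, 0 < q & metric a X X = - (Phi a)^-1 * q.
Proof.
move=> x0 xa tX X0.
have a0 : Phi a != 0 by case: xa => _; apply: contraTneq => ->; rewrite mulr0 ltxx.
have [c [v eX]] := tangent_level x0 tX.
exists (c * c + inner v v); last exact: metricE.
rewrite lt_def addr_ge0 ?inner_ge0 -?expr2 ?sqr_ge0 // andbT.
apply: contra X0; rewrite paddr_eq0 ?sqr_ge0 ?inner_ge0 // sqrf_eq0 inner_eq0.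
move=> /andP[/eqP c0 /eqP v0]; apply/eqP/(mul_tr_inj a0).
rewrite eX c0 v0 mul0mx; mx3; ring.
Qed.

(** The matrix e P^T, with the sign e opposite to that of Phi on the leaf, puts
    the Gram matrix in diagonal form and makes Phi negative.  It turns X a^T into
    P^T (X a^T) P, hence rotates the axial vectors, and multiplies Phi by e. *)
Lemma signed_rotation_leaf_map x P d e : su2_star x -> rotation P -> e ^+ 2 = 1 ->
  x *m x^T = P *m diag_mx d *m P^T -> e * Phi x < 0 ->
  leaf_map [set y | same_level x y] (Nleaf (d 0 0 - d 0 1) (d 0 1 - d 0 2%:R))
    (mulmx (e *: P^T)) (e *: P).
Proof.
move=> x0 rP e2 gx ex.
have MN : (e *: P^T) *m (e *: P) = 1%:M.
  by rewrite -scalemxAl -scalemxAr scalerA -expr2 e2 scale1r rP.1.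
have NM := mulmx1C MN.
have PhiM a : Phi ((e *: P^T) *m a) = e * Phi a.
  rewrite Phi_mul -mul_scalar_mx Phi_mul !Phi_det det_scalar det_tr rP.2 mulr1.
  by rewrite exprS e2 mulr1.
have PhiN a : Phi ((e *: P) *m a) = e * Phi a.
  rewrite Phi_mul -mul_scalar_mx Phi_mul !Phi_det det_scalar rP.2 mulr1.
  by rewrite exprS e2 mulr1.
have sm (M : E) S : smooth_near S (mulmx M : E -> E).
  exists setT => //; split; first exact: openT.
  by move=> n; exact/Ck_linear/linear_mx_continuous.
have dM (M a X : E) : 'd (mulmx M : E -> E) a X = M *m X.
  have := diff_lin (f := mulmx M) a (@linear_mx_continuous _ _ _ _ _).
  by move=> ->.
have gM (M a b : E) : (M *m a) *m (M *m b)^T = M *m (a *m b^T) *m M^T.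
  by rewrite trmx_mul !mulmxA.
split.
  exists (mulmx (e *: P)); split=> // [a [[t ga] pa]|b [bo b01 b12 pb]].
    split; last by rewrite mulmxA NM mul1mx.
    have gF : ((e *: P^T) *m a) *m ((e *: P^T) *m a)^T = diag_mx d + t%:M.
      rewrite gM ga gx linearZ /= trmxK -scalemxAl -!scalemxAr -scalemxAl scalerA -expr2 e2 scale1r.
      rewrite mulmxDr mulmxDl !mulmxA rP.1 mul1mx -mulmxA rP.1 mulmx1.
      by rewrite mul_mx_scalar -scalemxAl rP.1 scalemx1.
    have rF j k : inner (row j ((e *: P^T) *m a)) (row k ((e *: P^T) *m a)) =
        (diag_mx d + t%:M) j k.
      by rewrite -gF mulmx_trE.
    split; rewrite ?rF.
    - by move=> j k jk; rewrite rF !mxE (negbTE jk) !mulr0n addr0.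
    - by rewrite !mxE !eqxx !mulr1n; ring.
    - by rewrite !mxE !eqxx !mulr1n; ring.
    - by rewrite PhiM; nra.
  split; last by rewrite mulmxA MN mul1mx.
  have gb : b *m b^T = diag_mx d + (inner (row 0 b) (row 0 b) - d 0 0)%:M.
    apply/matrixP => j k; rewrite mulmx_trE !mxE; have [<-|jk] := eqVneq j k; last first.
      by rewrite bo // !mulr0n addr0.
    by rewrite !mulr1n; case: (ord3P j) => ->; lra.
  split; last by rewrite PhiN; nra.
  exists (inner (row 0 b) (row 0 b) - d 0 0).
  rewrite gM gb linearZ /= -scalemxAl -!scalemxAr -scalemxAl scalerA -expr2 e2 scale1r.
  rewrite mulmxDr mulmxDl gx mul_mx_scalar -scalemxAl (mulmx1C rP.1) scalemx1 //.
move=> a X Y j La tX tY.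
have a0 : Phi a != 0 by case: La => _; apply: contraTneq => ->; rewrite mulr0 ltxx.
have [c [u eX]] := tangent_level x0 tX; have [c' [v eY]] := tangent_level x0 tY.
have Fa0 : Phi ((e *: P^T) *m a) != 0.
  by rewrite PhiM mulf_neq0 //; apply: contra_eq_neq e2 => ->; rewrite expr0n eq_sym oner_eq0.
have eF q w Z : Z *m a^T = qmx q w ->
    ((e *: P^T) *m Z) *m ((e *: P^T) *m a)^T = qmx q (w *m P).
  move=> eZ; rewrite gM eZ linearZ /= trmxK -scalemxAl -!scalemxAr -scalemxAl.
  rewrite scalerA -expr2 e2 scale1r.
  by rewrite qmx_conj ?(cof_rotation rP.1 rP.2) // rP.1.
rewrite !dM (omegaE j Fa0 (eF _ _ _ eX) (eF _ _ _ eY)) PhiM.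
rewrite bracket_mulmx (cof_rotation rP.1 rP.2) !scalemxAl -mulmxBl -mulmxDl mxE mulr_sumr.
have ei : e^-1 = e by apply: (mulfI (_ : e != 0)); rewrite ?mulfV -?expr2 ?e2 //;
  apply: contra_eq_neq e2 => ->; rewrite expr0n eq_sym oner_eq0.
apply: eq_bigr => i _; rewrite (omegaE i a0 eX eY) invfM ei !mxE; ring.
Qed.

End LevelGeometry.

Theorem theorem3p12 (R : realType) (i : 'I_3) (L : set 'M[R]_3)
    (hL : symplectic_leaf (poisson i) (@su2_star R) L) :
  ((metric_posdef L <-> L `<=` @su2_minus R) /\
   (metric_posdef L ->
      exists q r : R, [/\ 0 <= q, 0 <= r & isomorphic L (Nleaf q r)])) /\
  ((metric_negdef L <-> L `<=` @su2_plus R) /\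
   (metric_negdef L ->
      exists q' r' : R, [/\ 0 <= q', 0 <= r' & anti_isomorphic L (Nleaf q' r')])).
Proof.
have [x x0 ->] := symplectic_leafE hL.
have [P [d [PP dP gx d01 d12]]] : exists (P : 'M[R]_3) d, [/\ P^T *m P = 1%:M, \det P = 1,
     x *m x^T = P *m diag_mx d *m P^T, d 0 1 <= d 0 0 & d 0 2%:R <= d 0 1].
  by apply: symmetric_diagonalizable; rewrite trmx_mul trmxK.
have eqx := same_level_refl x0.
have pos : metric_posdef [set y | same_level x y] <-> [set y | same_level x y] `<=` @su2_minus R.
  split=> [h a xa|h a X xa tX X0].
    have [X tX X0] := tangent_exists xa.
    have [q q0 mq] := metric_sign x0 xa tX X0.
    by have := h a X xa tX X0; rewrite mq pmulr_lgt0 // oppr_gt0 invr_lt0.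
  have [q q0 ->] := metric_sign x0 xa tX X0.
  by rewrite pmulr_lgt0 // oppr_gt0 invr_lt0; exact: h.
have neg : metric_negdef [set y | same_level x y] <-> [set y | same_level x y] `<=` @su2_plus R.
  split=> [h a xa|h a X xa tX X0].
    have [X tX X0] := tangent_exists xa.
    have [q q0 mq] := metric_sign x0 xa tX X0.
    by have := h a X xa tX X0; rewrite mq pmulr_llt0 // oppr_lt0 invr_gt0.
  have [q q0 ->] := metric_sign x0 xa tX X0.
  by rewrite pmulr_llt0 // oppr_lt0 invr_gt0; exact: h.
have orth e : e ^+ 2 = 1 -> (e *: P)^T *m (e *: P) = 1%:M.
  by move=> e2; rewrite -scalemxAr linearZ /= -scalemxAl scalerA -expr2 e2 scale1r.
have detP e : e ^+ 2 = 1 -> \det (e *: P) = e.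
  by move=> e2; rewrite detZ dP mulr1 exprS e2 mulr1.
split; split=> //.
- move=> /pos.1/(_ x eqx) px; exists (d 0 0 - d 0 1), (d 0 1 - d 0 2%:R).
  rewrite !subr_ge0; split=> //; exists (mulmx (1 *: P^T)), (1 *: P).
  have e2 : (1 : R) ^+ 2 = 1 by rewrite expr1n.
  by split; [exact: orth|exact: detP|apply: signed_rotation_leaf_map; rewrite ?mul1r].
- move=> /neg.1/(_ x eqx) px; exists (d 0 0 - d 0 1), (d 0 1 - d 0 2%:R).
  rewrite !subr_ge0; split=> //; exists (mulmx ((-1) *: P^T)), ((-1) *: P).
  have e2 : (-1 : R) ^+ 2 = 1 by rewrite sqrrN expr1n.
  split; [exact: orth|exact: detP|apply: signed_rotation_leaf_map => //].
  by rewrite mulN1r oppr_lt0.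
Qed.
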